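(* Assume that $m,m'\in\mathcal{M}_{r}$ and that $m'$ is a rigid extremal tree measure. If $\Sigma_{m'}(m)=-p<0$, then $pm'\le m$, and (when $m$ has integer densities, so that $c_m$ is defined) $c_{m-pm'}=c_{m}$.
   Context: **Measures.** Let $u,v,w$ be unit vectors in the plane pointing at angles $240^\circ,0^\circ,120^\circ$ (so $u+v+w=0$). Lattice points are the points $iu+jv$, $i,j\in\mathbb{Z}$; a small edge is a segment joining two lattice points at distance $1$. All measures $m$ are positive, supported by the union of the small edges, have restriction to each small edge $e$ equal to a constant $m(e)\ge0$ (the density) times arclength, and satisfy the balance condition $m(AB)-m(AB')=m(AC)-m(AC')=m(AD)-m(AD')$ whenever $A$ is a lattice point whose neighboring lattice points are $B,C',D,B',C,D'$ in cyclic order. A branch point of $m$ is a lattice point incident to at least three small edges in the support of $m$. For $r\ge1$, $\triangle_r$ is the closed triangle with vertices $0,\,ru,\,ru+rv=-rw$. Put $A_j=ju$, $B_j=ru+jv$, $C_j=-(r-j)w$, and $X_j=A_j+w$, $Y_j=B_j+u$, $Z_j=C_j+v$. $\mathcal{M}_r$ consists of the zero measure and all such measures $m$ that have at least one branch point, have all branch points in $\triangle_r$, and satisfy $m(A_jX_{j+1})=m(B_jY_{j+1})=m(C_jZ_{j+1})=0$ for $j=0,\dots,r$. The exit densities of $m$ are $\alpha_j=m(A_jX_j)$, $\beta_j=m(B_jY_j)$, $\gamma_j=m(C_jZ_j)$, $0\le j\le r$; the weight is $\omega(m)=\sum_j\alpha_j=\sum_j\beta_j=\sum_j\gamma_j$.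 We write $m_1\le m_2$ if $m_1(e)\le m_2(e)$ for all small edges $e$. A measure $0\ne m\in\mathcal{M}_r$ is extremal if every $m_1\in\mathcal{M}_r$ with $m_1\le m$ is a multiple of $m$. A measure $m\in\mathcal{M}_r$ is rigid if no other measure in $\mathcal{M}_r$ has the same exit densities. **Coefficient $c_m$.** For $m\in\mathcal{M}_r$ with integer densities, $c_m$ is the number of measures in $\mathcal{M}_r$ with integer densities having the same exit densities as $m$. (It is known that $c_m$ equals the Littlewood-Richardson coefficient $c_{IJK}$ where, with $n=r+\omega(m)$, $I=\{i_1<\dots<i_r\}\subset\{1,\dots,n\}$, $i_\ell=\ell+\sum_{j=0}^{\ell-1}\alpha_j$, and $J,K$ are defined likewise from $\beta_j,\gamma_j$.) **The sum $\Sigma$.** For $m,m'\in\mathcal{M}_r$ with exit densities $\alpha_\ell,\beta_\ell,\gamma_\ell$ and $\alpha'_\ell,\beta'_\ell,\gamma'_\ell$, $$\Sigma_{m'}(m)=\sum_{0\le\ell<\ell'\le r}(\alpha_\ell\alpha'_{\ell'}+\beta_\ell\beta'_{\ell'}+\gamma_\ell\gamma'_{\ell'})-\omega(m)\omega(m').$$ **Trees.** A tree here is a tree embedded in the plane such that: (1) each edge is a straight segment of length 1; (2) each vertex has order 2 or 3; (3) only finitely many vertices have order 3; (4) the shortest path joining two different ends contains an odd number of vertices of order 3, where an end is a sequence $V_0V_1\cdots$ of vertices with $V_0$ of order 3, $V_j$ of order 2 for $j\ge1$, and each $V_jV_{j+1}$ an edge. An immersion of a tree $T$ is a continuous $\varphi:T\to\mathbb{R}^2$,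 isometric on each edge, with $2\varphi(V)=\varphi(A)+\varphi(B)$ if $VA,VB$ are the edges at an order-2 vertex $V$, and with $3\varphi(V)=\varphi(A)+\varphi(B)+\varphi(C)$ and $\varphi$ orientation preserving on $VA\cup VB\cup VC$ if these are the edges at an order-3 vertex $V$. If $\varphi$ maps edges of $T$ onto small edges, $m_\varphi$ denotes the push-forward of arclength measure (so $m_\varphi(e)$ is the number of edges of $T$ mapped onto $e$); $m\in\mathcal{M}_r$ is a tree measure if $m=m_\varphi$ for such an immersion of a tree. *)

(* Defs.v *)
From mathcomp Require Import all_boot all_order all_algebra.
From mathcomp Require Import finmap.
From mathcomp Require Import all_classical all_reals all_analysis.
Set Implicit Arguments.
Unset Strict Implicit.
Unset Printing Implicit Defensive.
Import Order.TTheory GRing.Theory Num.Theory.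
Import numFieldNormedType.Exports.
Local Open Scope classical_set_scope.
Local Open Scope ring_scope.

Section Plane.
Variable R : realType.

Definition plane : Type := (R * R)%type.

(* The norm the library puts on R * R is the sup norm. *)
Definition eucl_dist (x y : plane) : R :=
  Num.sqrt ((x.1 - y.1) ^+ 2 + (x.2 - y.2) ^+ 2).

Definition segment (x y : plane) : set plane :=
  [set (1 - t) *: x + t *: y | t in `[0, 1]].

(* Twice the signed area of the triangle abc.  If a, b, c are distinct points
   of a circle, it is positive exactly when they are in counterclockwise order
   around the center of that circle. *)
Definition orient (a b c : plane) : R :=
  (b.1 - a.1) * (c.2 - a.2) - (b.2 - a.2) * (c.1 - a.1).

End Plane.

(* The pair (i, j) stands for the lattice point i u + j v. *)
Definition lattice : Type := (int * int)%type.

Definition lu : lattice := (1, 0).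
Definition lv : lattice := (0, 1).
Definition lw : lattice := - lu - lv.

Section Measures.
Variable R : realType.

Definition pu : plane R := (- 2^-1, - (Num.sqrt 3 / 2)).
Definition pv : plane R := (1, 0).

Definition pt (P : lattice) : plane R := P.1%:~R *: pu + P.2%:~R *: pv.

Definition small_edge (P Q : lattice) : Prop := eucl_dist (pt P) (pt Q) = 1.

(* A measure is given by its densities: m P Q is the density of m on the small
   edge PQ, and is_measure makes it 0 on the other pairs of lattice points, so
   that equality of measures is equality of functions. *)
Definition density : Type := lattice -> lattice -> R.

(* The neighbors of A are, in counterclockwise order, A + v, A - u, A + w,
   A - v, A + u, A - w. *)
Definition balanced (m : density) : Prop :=
  forall A,
    m A (A + lu) - m A (A - lu) = m A (A + lv) - m A (A - lv) /\
    m A (A + lv) - m A (A - lv) = m A (A + lw) - m A (A - lw).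

Definition is_measure (m : density) : Prop :=
  [/\ forall P Q, m P Q = m Q P,
      forall P Q, 0 <= m P Q,
      forall P Q, ~ small_edge P Q -> m P Q = 0
    & balanced m].

Definition branch_point (m : density) (P : lattice) : Prop :=
  exists Q1 Q2 Q3 : lattice,
    [/\ uniq [:: Q1; Q2; Q3], small_edge P Q1 /\ 0 < m P Q1,
        small_edge P Q2 /\ 0 < m P Q2 & small_edge P Q3 /\ 0 < m P Q3].

Definition measure_le (m1 m2 : density) : Prop :=
  forall P Q, small_edge P Q -> m1 P Q <= m2 P Q.

Definition integer_densities (m : density) : Prop :=
  forall P Q, small_edge P Q -> m P Q \is a Num.int.

Section Exits.
Variable r : nat.

Definition triangle : set (plane R) :=
  [set x | exists a b c : R, [/\ 0 <= a, 0 <= b, 0 <= c, a + b + c = 1 &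
     x = a *: pt 0 + b *: pt (lu *+ r) + c *: pt (lu *+ r + lv *+ r)]].

Definition ptA (j : nat) : lattice := lu *+ j.
Definition ptB (j : nat) : lattice := lu *+ r + lv *+ j.
(* The coefficient is an integer: j = r + 1 is used below. *)
Definition ptC (j : nat) : lattice := - (lw *~ (r%:Z - j%:Z)).
Definition ptX (j : nat) : lattice := ptA j + lw.
Definition ptY (j : nat) : lattice := ptB j + lu.
Definition ptZ (j : nat) : lattice := ptC j + lv.

Definition in_M (m : density) : Prop :=
  is_measure m /\
  (m = 0 \/
   [/\ exists P, branch_point m P,
       forall P, branch_point m P -> triangle (pt P)
     & forall j, (j <= r)%N ->
         [/\ m (ptA j) (ptX j.+1) = 0, m (ptB j) (ptY j.+1) = 0
           & m (ptC j) (ptZ j.+1) = 0]]).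

Definition alpha (m : density) (j : nat) : R := m (ptA j) (ptX j).
Definition beta (m : density) (j : nat) : R := m (ptB j) (ptY j).
Definition gamma (m : density) (j : nat) : R := m (ptC j) (ptZ j).

Definition weight (m : density) : R := \sum_(j < r.+1) alpha m j.

Definition same_exit (m1 m2 : density) : Prop :=
  forall j, (j <= r)%N ->
    [/\ alpha m1 j = alpha m2 j, beta m1 j = beta m2 j
      & gamma m1 j = gamma m2 j].

Definition extremal (m : density) : Prop :=
  [/\ in_M m, m <> 0 &
      forall m1, in_M m1 -> measure_le m1 m -> exists c : R, m1 = c *: m].

Definition rigid (m : density) : Prop :=
  in_M m /\ forall m1, in_M m1 -> same_exit m1 m -> m1 = m.

Definition coef_set (m : density) : set density :=
  [set m1 | [/\ in_M m1, integer_densities m1 & same_exit m1 m]].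

(* coef_set m is finite (it has a Littlewood-Richardson coefficient as its
   cardinality), so fset_set does not return its default value. *)
Definition coef (m : density) : nat := #|` fset_set (coef_set m)|%fset.

Definition Sigma (m' m : density) : R :=
  (\sum_(l < r.+1) \sum_(l' < r.+1 | (l < l')%N)
     (alpha m l * alpha m' l' + beta m l * beta m' l' + gamma m l * gamma m' l'))
  - weight m * weight m'.

End Exits.

End Measures.

Section Trees.
Variable R : realType.
Implicit Types (V : set (plane R)) (e : rel (plane R)).

Definition vorder e (x : plane R) (n : nat) : Prop :=
  ([set y | e x y] #= `I_n)%card.

(* Injectivity rules out walks going back and forth along an edge. *)
Definition tree_end e (s : nat -> plane R) : Prop :=
  [/\ injective s, vorder e (s 0%N) 3,
      forall j, vorder e (s j.+1) 2 & forall j, e (s j) (s j.+1)].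

(* The sequence x :: p is a path from a vertex of the end s to a vertex of the
   end t. *)
Definition joins e (s t : nat -> plane R) (x : plane R) (p : seq (plane R)) :
    Prop :=
  [/\ path e x p, exists i, x = s i & exists j, last x p = t j].

Definition shortest_joining e s t x p : Prop :=
  joins e s t x p /\
  forall y q, joins e s t y q -> (size p <= size q)%N.

Record tree := Tree {
  vertex : set (plane R);
  adj : rel (plane R);
  adj_sym : symmetric adj;
  adj_vertex : forall x y, adj x y -> vertex x;
  tree_nonempty : vertex !=set0;
  tree_connected : forall x y, vertex x -> vertex y ->
    exists2 p, path adj x p & last x p = y;
  tree_acyclic : forall c, (2 < size c)%N -> ~ ucycle adj c;
  edge_length : forall x y, adj x y -> eucl_dist x y = 1;
  (* Two different edges meet at most in common end points. *)
  edges_meet : forall x y x' y' z, adj x y -> adj x' y' ->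
    segment x y <> segment x' y' -> segment x y z -> segment x' y' z ->
    (z = x \/ z = y) /\ (z = x' \/ z = y');
  (* The topology of the tree is the one induced by the plane: edges do not
     accumulate at a point of the tree. *)
  edges_locally : forall x y z, adj x y -> segment x y z ->
    exists2 d : R, 0 < d & forall x' y' z', adj x' y' ->
      segment x' y' z' -> eucl_dist z z' < d -> segment x' y' z;
  vertex_order : forall x, vertex x -> vorder adj x 2 \/ vorder adj x 3;
  finite_order3 : finite_set [set x | vertex x /\ vorder adj x 3];
  ends_parity : forall s t x p, tree_end adj s -> tree_end adj t -> s <> t ->
    shortest_joining adj s t x p ->
    odd (count (fun y => `[< vorder adj y 3 >]) (x :: p))
}.

Definition is_edge (T : tree) (S : set (plane R)) : Prop :=
  exists x y, adj T x y /\ S = segment x y.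

Definition carrier (T : tree) : set (plane R) :=
  \bigcup_(S in is_edge T) S.

Definition immersion (T : tree) (phi : plane R -> plane R) : Prop :=
  [/\ {within carrier T, continuous phi},
      forall S, is_edge T S -> forall a b, S a -> S b ->
        eucl_dist (phi a) (phi b) = eucl_dist a b,
      forall x a b, vorder (adj T) x 2 -> a <> b -> adj T x a -> adj T x b ->
        phi x *+ 2 = phi a + phi b
    & (* orient applies because a, b, c lie on the unit circle around x and
         their images on the one around phi x. *)
      forall x a b c, vorder (adj T) x 3 -> uniq [:: a; b; c] ->
        adj T x a -> adj T x b -> adj T x c ->
        phi x *+ 3 = phi a + phi b + phi c /\
        (0 < orient a b c -> 0 < orient (phi a) (phi b) (phi c))].

Definition onto_small_edges (T : tree) (phi : plane R -> plane R) : Prop :=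
  forall S, is_edge T S ->
    exists P Q, small_edge R P Q /\ phi @` S = segment (pt R P) (pt R Q).

(* m is the push-forward by phi of the arclength measure of T. *)
Definition is_pushforward (T : tree) (phi : plane R -> plane R)
    (m : density R) : Prop :=
  forall P Q, small_edge R P Q -> exists n : nat,
    ([set S | is_edge T S /\ phi @` S = segment (pt R P) (pt R Q)] #= `I_n)%card /\
    m P Q = n%:R.

Definition tree_measure (r : nat) (m : density R) : Prop :=
  in_M r m /\
  exists (T : tree) (phi : plane R -> plane R),
    [/\ immersion T phi, onto_small_edges T phi & is_pushforward T phi m].

End Trees.

(* Main.v *)
Require Import Defs.
From HB Require Import structures.
From mathcomp Require Import all_boot all_order all_algebra.
From mathcomp Require Import finmap.
From mathcomp Require Import all_classical all_reals all_analysis.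
From mathcomp Require Import ring lra zify.
Set Implicit Arguments.
Unset Strict Implicit.
Unset Printing Implicit Defensive.
Import Order.TTheory GRing.Theory Num.Theory.
Import numFieldNormedType.Exports.
Local Open Scope ring_scope.

(* Summation by parts turns Sigma_{m'}(m) into a sum over lattice points of a
   bilinear expression in the densities of m and m' near the point.  When m' is
   the image of a tree T, this becomes a sum over the vertices of T.  Root T at
   an edge e: by the balance condition, the contribution of a vertex is the
   total density of m on the edges to its children plus the density of m on one
   further small edge, its slack.  The children's densities cancel against the
   edge terms, and Sigma_{m'}(m) = (sum of the slacks) - m(e).

   For m = m', the sum of the slacks is at least m'(e) - 1.  Indeed let f be
   another edge of T with the same image as e, and walk in T from e and from f
   in parallel, making the same turns; where the two walks first see vertices
   of different kinds, the second one uses the slack edge of the first one.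
   They must differ somewhere, for otherwise T would have a translation that
   does not move the image, and infinitely many edges over a small edge.

   Now let e minimize rho = m(e) / m'(e).  Then m >= rho m', so the sum of the
   slacks of m is at least rho (m'(e) - 1) and Sigma_{m'}(m) >= - rho; hence
   p <= rho and p m' <= m.  Since Sigma_{m'} only depends on exit densities,
   subtracting p m' is a bijection between the sets counted by c_m and
   c_{m - p m'}. *)

(** * Summation by parts on a square *)

Section SquareFlow.
Variable R : comPzRingType.
Implicit Types f g : nat -> R.

Lemma summation_by_parts f g n : f 0%N = 0 ->
  \sum_(i < n) f i.+1 * (g i.+1 - g i) =
  f n * g n - \sum_(i < n) (f i.+1 - f i) * g i.
Proof.
move=> f0; elim: n => [|n IHn]; first by rewrite !big_ord0 f0; ring.
by rewrite !big_ord_recr /= IHn; ring.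
Qed.

Variable r : nat.

(* [a i j], [b i j], [c i j] are the densities of the edges that enter the
   point [i u + j v] in the directions [u], [v], [-w]; the last condition and
   the vanishing of [c 0 j.+1] say that nothing leaves the square except
   through the exits. *)
Record square_flow (a b c : nat -> nat -> R) : Prop := SquareFlow {
  flow_ab : forall i j, (i <= r)%N -> (j <= r)%N ->
    b i j.+1 - b i j = a i.+1 j - a i j;
  flow_ac : forall i j, (i <= r)%N -> (j <= r)%N ->
    c i.+1 j.+1 = c i j - (a i.+1 j - a i j);
  flow_a0 : forall j, (j <= r)%N -> a 0%N j = 0;
  flow_b0 : forall i, (i <= r)%N -> b i 0%N = 0;
  flow_c0 : forall j, (j < r)%N -> c 0%N j.+1 = 0;
  flow_c_right : forall j, (j <= r)%N -> c r.+1 j.+1 = 0;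
  flow_c_top : forall i, (i <= r)%N -> c i.+1 r.+1 = 0 }.

Section PartialSums.
Variables a b c : nat -> nat -> R.
Hypothesis flow : square_flow a b c.

Let rowsum i j := \sum_(k < i) c k.+1 j.+1.
Let colsum i j := \sum_(k < j) a i k.
Let w := \sum_(k < r.+1) c k 0%N.

(** By [flow_ac], a diagonal shift changes the row sum of [c] by the increments of [a]. These
    telescope from [a 0 j.+1 = 0], and the extra left term [c 0 j.+1] vanishes. *)
Lemma rowsumS i j : (i <= r)%N -> (j < r)%N ->
  rowsum i.+1 j.+1 = rowsum i j - a i.+1 j.+1.
Proof.
move=> ir jr; elim: i ir => [|i IHi] ir.
  rewrite /rowsum big_ord_recr !big_ord0 /= (flow_ac flow) //.
  by rewrite (flow_c0 flow) // (flow_a0 flow) //; ring.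
have := IHi (ltnW ir); rewrite /rowsum => E.
rewrite big_ord_recr /= E [in RHS]big_ord_recr /=.
by rewrite (flow_ac flow ir) //; ring.
Qed.

Lemma rowsum0 i : (i <= r)%N ->
  rowsum i.+1 0 = \sum_(k < i.+1) c k 0%N - a i.+1 0%N.
Proof.
elim: i => [|i IHi] ir.
  rewrite /rowsum !big_ord_recr !big_ord0 /= (flow_ac flow) //.
  by rewrite (flow_a0 flow) //; ring.
have := IHi (ltnW ir); rewrite /rowsum => E.
rewrite big_ord_recr /= E [in RHS]big_ord_recr /=.
by rewrite (flow_ac flow ir) //; ring.
Qed.

Lemma colsumS i j : (i <= r)%N -> (j <= r.+1)%N ->
  colsum i.+1 j = colsum i j + b i j.
Proof.
move=> ir; elim: j => [|j IHj] jr.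
  by rewrite /colsum !big_ord0 (flow_b0 flow) // addr0.
have := IHj (ltnW jr); rewrite /colsum => E.
rewrite !big_ord_recr /= E.
by have := flow_ab flow ir (jr : (j <= r)%N) => /(canRL (subrK _)) ->; ring.
Qed.

(** Since the last term [c r.+1 j.+1] of a full row is 0, [rowsumS] compares full rows: each new row
    loses exactly the exit density through the right side. *)
Lemma rowsum_exit j : (j <= r)%N ->
  rowsum r.+1 j = w - \sum_(k < j.+1) a r.+1 k.
Proof.
elim: j => [|j IHj] jr; first by rewrite rowsum0 // big_ord1.
rewrite rowsumS // big_ord_recr /= opprD addrA -IHj ?(ltnW jr) //.
by rewrite {2}/rowsum big_ord_recr /= (flow_c_right flow) ?(ltnW jr) // addr0.
Qed.

(** The full row sum at height [r] vanishes by [flow_c_top], so the exits through the right side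
    exhaust [w]. For measures this is the equality of the sums of the [alpha_j] and of the
    [beta_j]. *)
Lemma sum_exit_a : \sum_(k < r.+1) a r.+1 k = w.
Proof.
apply/eqP; rewrite eq_sym -subr_eq0 -rowsum_exit // /rowsum; apply/eqP.
by apply: big1 => k _; rewrite (flow_c_top flow) // -ltnS ltn_ord.
Qed.

Lemma colsum_exit i : (i <= r.+1)%N ->
  colsum i r.+1 = \sum_(k < i) b k r.+1.
Proof.
elim: i => [|i IHi] ir.
  rewrite big_ord0 /colsum; apply: big1 => k _.
  by rewrite (flow_a0 flow) // -ltnS ltn_ord.
by rewrite colsumS // IHi ?(ltnW ir) // big_ord_recr.
Qed.

Lemma sum_turn : \sum_(i < r.+1) \sum_(j < r.+1) (a i.+1 j - a i j) = w.
Proof.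
rewrite exchange_big /= -sum_exit_a; apply: eq_bigr => j _.
rewrite -(big_mkord xpredT (fun i => a i.+1 j - a i j)) telescope_sumr //.
by rewrite (flow_a0 flow) ?subr0 // -ltnS ltn_ord.
Qed.

Let diagsum i j := w - (a i.+1 j - a i j) - rowsum i.+1 j - colsum i j.+1.

(** What [w] leaves after the turn, the row sum and the column sum is, up to sign, a primitive of
    [b] along diagonals. This closes the cycle between the three families of edges. *)
Lemma diagsumS i j : (i < r)%N -> (j < r)%N ->
  diagsum i j - diagsum i.+1 j.+1 = b i j.
Proof.
move=> ir jr; rewrite /diagsum rowsumS //.
have -> : colsum i.+1 j.+2 = colsum i.+1 j.+1 + a i.+1 j.+1.
  by rewrite /colsum big_ord_recr.
rewrite colsumS ?(ltnW ir) ?(ltnW jr) //; last by rewrite ltnW.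
have := flow_ab flow (ltnW ir) (ltnW jr) => /(canRL (subrK _)) ->; ring.
Qed.

Lemma diagsum0 i : (i <= r)%N ->
  diagsum i 0 = w - \sum_(k < i.+1) c k 0%N.
Proof.
move=> ir; rewrite /diagsum rowsum0 // /colsum big_ord1; ring.
Qed.

End PartialSums.

Section Bilinear.
Variables a b c a' b' c' : nat -> nat -> R.
Hypotheses (flow : square_flow a b c) (flow' : square_flow a' b' c').

Let w := \sum_(k < r.+1) c k 0%N.
Let w' := \sum_(k < r.+1) c' k 0%N.
Let t i j := a i.+1 j - a i j.
Let t' i j := a' i.+1 j - a' i j.

(* Summation by parts with [p], [q], [s] the primitives of [c'], [a'], [b']
   along rows, columns and diagonals: they satisfy [p + q + s + t' = w']. *)
Lemma sum_flow_pairing :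
  \sum_(i < r.+1) \sum_(j < r.+1)
    (a' i j * b i j + b' i j * c i.+1 j.+1 + c' i.+1 j.+1 * a i j
     - t i j * t' i j) =
  \sum_(i < r.+1) (w' - \sum_(k < i.+1) c' k 0%N) * c i 0%N
  + \sum_(j < r.+1) (w' - \sum_(k < j.+1) a' r.+1 k) * a r.+1 j
  + \sum_(i < r.+1) (\sum_(k < i) b' k r.+1) * b i r.+1 - w * w'.
Proof.
pose p i j := \sum_(k < i) c' k.+1 j.+1.
pose q i j := \sum_(k < j) a' i k.
pose s i j := w' - t' i j - p i.+1 j - q i j.+1.
have Ep : \sum_(i < r.+1) \sum_(j < r.+1) p i.+1 j * t i j =
    \sum_(j < r.+1) (w' - \sum_(k < j.+1) a' r.+1 k) * a r.+1 j
    - \sum_(i < r.+1) \sum_(j < r.+1) c' i.+1 j.+1 * a i j.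
  rewrite exchange_big [X in _ - X]exchange_big /= -sumrB.
  apply: eq_bigr => j _; have jr : (j <= r)%N by rewrite -ltnS.
  rewrite (summation_by_parts (f := p ^~ j) (a ^~ j)); last by rewrite /p big_ord0.
  rewrite /p (rowsum_exit flow' jr); congr (_ - _).
  by apply: eq_bigr => i _; rewrite big_ord_recr /= addrAC subrr add0r.
have Eq : \sum_(i < r.+1) \sum_(j < r.+1) q i j.+1 * t i j =
    \sum_(i < r.+1) (\sum_(k < i) b' k r.+1) * b i r.+1
    - \sum_(i < r.+1) \sum_(j < r.+1) a' i j * b i j.
  rewrite -sumrB; apply: eq_bigr => i _.
  have ir : (i <= r)%N by rewrite -ltnS.
  transitivity (\sum_(j < r.+1) q i j.+1 * (b i j.+1 - b i j)).
    by apply: eq_bigr => j _; rewrite /t (flow_ab flow) // -ltnS.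
  rewrite (summation_by_parts (f := q i) (b i)); last by rewrite /q big_ord0.
  rewrite /q (colsum_exit flow' (leqW ir)); congr (_ - _).
  by apply: eq_bigr => j _; rewrite big_ord_recr /= addrAC subrr add0r.
have Es : \sum_(i < r.+1) \sum_(j < r.+1) s i j * t i j =
    \sum_(i < r.+1) (w' - \sum_(k < i.+1) c' k 0%N) * c i 0%N
    - \sum_(i < r.+1) \sum_(j < r.+1) b' i j * c i.+1 j.+1.
  (* The terms with [i = r] or [j = r] vanish by [flow_c_right] and [flow_c_top], so both sums can
     be reindexed along diagonals. *)
  have E (x : nat -> nat -> R) :
      \sum_(i < r.+1) \sum_(j < r.+1) x i j * c i.+1 j.+1 =
      \sum_(i < r) \sum_(j < r) x i j * c i.+1 j.+1.
    rewrite big_ord_recr /= [X in _ + X]big1 ?addr0; last first.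
      by move=> j _; rewrite (flow_c_right flow) ?mulr0 // -ltnS.
    apply: eq_bigr => i _; rewrite big_ord_recr /= (flow_c_top flow) ?mulr0 ?addr0 //.
    exact: ltnW.
  have E1 : \sum_(i < r.+1) \sum_(j < r.+1) s i j * t i j =
     \sum_(i < r.+1) \sum_(j < r.+1) s i j * c i j
     - \sum_(i < r.+1) \sum_(j < r.+1) s i j * c i.+1 j.+1.
    rewrite -sumrB; apply: eq_bigr => i _; rewrite -sumrB; apply: eq_bigr => j _.
    have ir : (i <= r)%N by rewrite -ltnS.
    have jr : (j <= r)%N by rewrite -ltnS.
    by rewrite (flow_ac flow ir jr) /t; ring.
  have E2 : \sum_(i < r.+1) \sum_(j < r.+1) s i j * c i j =
      \sum_(i < r.+1) s i 0%N * c i 0%N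
      + \sum_(i < r) \sum_(j < r) s i.+1 j.+1 * c i.+1 j.+1.
    rewrite (eq_bigr (fun i : 'I_r.+1 => s i 0%N * c i 0%N +
       \sum_(j < r) s i j.+1 * c i j.+1)); last first.
      by move=> i _; rewrite big_ord_recl.
    rewrite big_split /=; congr (_ + _); rewrite big_ord_recl /=.
    rewrite [X in X + _]big1 ?add0r // => j _.
    by rewrite (flow_c0 flow) ?mulr0.
  rewrite E1 E2 !E -addrA; congr (_ + _).
    apply: eq_bigr => i _; have ir : (i <= r)%N by rewrite -ltnS.
    by rewrite /s /p /q (diagsum0 flow' ir).
  rewrite -sumrB -sumrN; apply: eq_bigr => i _.
  rewrite -sumrB -sumrN; apply: eq_bigr => j _.
  rewrite -mulrBl -mulNr -(diagsumS flow' (ltn_ord i) (ltn_ord j)).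
  by congr (_ * _); rewrite -(opprB (s i j)).
have Et : \sum_(i < r.+1) \sum_(j < r.+1) (w' - t' i j) * t i j =
    w * w' - \sum_(i < r.+1) \sum_(j < r.+1) t i j * t' i j.
  have -> : w = \sum_(i < r.+1) \sum_(j < r.+1) t i j by rewrite /t (sum_turn flow).
  rewrite mulr_suml -sumrB; apply: eq_bigr => i _.
  by rewrite mulr_suml -sumrB; apply: eq_bigr => j _; rewrite mulrBl [w' * _]mulrC [t' i j * _]mulrC.
have Epqs : \sum_(i < r.+1) \sum_(j < r.+1) (w' - t' i j) * t i j =
    \sum_(i < r.+1) \sum_(j < r.+1) p i.+1 j * t i j
    + \sum_(i < r.+1) \sum_(j < r.+1) q i j.+1 * t i j
    + \sum_(i < r.+1) \sum_(j < r.+1) s i j * t i j.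
  rewrite -!big_split; apply: eq_bigr => i _ /=.
  rewrite -!big_split; apply: eq_bigr => j _ /=; rewrite -!mulrDl; congr (_ * _).
  have split (x y z : R) : x = y + z + (x - y - z) by ring.
  exact: split.
(* [W - T] is the sum of [Et]; [P1], [Q1], [S1] stand for the boundary terms of [Ep], [Eq], [Es],
   and [P2], [Q2], [S2] for their double sums. *)
have arith (W T P1 P2 Q1 Q2 S1 S2 : R) :
    W - T = P1 - P2 + (Q1 - Q2) + (S1 - S2) ->
    Q2 + S2 + P2 - T = S1 + P1 + Q1 - W.
  by move=> /(canRL (subKr _)) ->; ring.
rewrite -(arith _ _ _ _ _ _ _ _ (etrans (esym Et) (etrans Epqs
  (congr2 +%R (congr2 +%R Ep Eq) Es)))).
rewrite -sumrN -!big_split; apply: eq_bigr => i _ /=.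
by rewrite -sumrN -!big_split.
Qed.

End Bilinear.
End SquareFlow.

(** * Directions and lattice points *)

(* The six directions of small edges, in counterclockwise order: [dV], [dW],
   [dU] are those of [v], [w], [u] and [dNV], [dNW], [dNU] their opposites. *)
Inductive dir := dV | dNU | dW | dNV | dU | dNW.

Definition dir_code d : nat :=
  match d with dV => 0 | dNU => 1 | dW => 2 | dNV => 3 | dU => 4 | dNW => 5 end.
Definition dir_decode n :=
  match n with 0 => dV | 1 => dNU | 2 => dW | 3 => dNV | 4 => dU | _ => dNW end%N.
Lemma dir_codeK : cancel dir_code dir_decode. Proof. by case. Qed.
HB.instance Definition _ := Countable.copy dir (can_type dir_codeK).

Definition opp d :=
  match d with
  | dV => dNV | dNU => dU | dW => dNW | dNV => dV | dU => dNU | dNW => dW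
  end.
Definition rot d :=
  match d with
  | dV => dNU | dNU => dW | dW => dNV | dNV => dU | dU => dNW | dNW => dV
  end.
(** The directions of the exit edges: [w] at the points [A_j], [u] at the [B_j], [v] at the
    [C_j]. *)
Definition outward d := match d with dV | dW | dU => true | _ => false end.

Lemma oppK : involutive opp. Proof. by case. Qed.
Lemma opp_neq d : opp d != d. Proof. by case: d. Qed.
Lemma outward_opp d : outward (opp d) = ~~ outward d. Proof. by case: d. Qed.

Definition dv d : lattice :=
  match d with
  | dV => (0, 1) | dNU => (-1, 0) | dW => (-1, -1)
  | dNV => (0, -1) | dU => (1, 0) | dNW => (1, 1)
  end.

Lemma lattice_fstD (P Q : lattice) : (P + Q).1 = P.1 + Q.1. Proof. by []. Qed.
Lemma lattice_sndD (P Q : lattice) : (P + Q).2 = P.2 + Q.2. Proof. by []. Qed.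
Lemma lattice_fstMn (P : lattice) n : (P *+ n).1 = P.1 * n%:Z.
Proof.
elim: n => [|n IHn]; first by rewrite mulr0n mulr0.
by rewrite mulrS lattice_fstD IHn; lia.
Qed.
Lemma lattice_sndMn (P : lattice) n : (P *+ n).2 = P.2 * n%:Z.
Proof.
elim: n => [|n IHn]; first by rewrite mulr0n mulr0.
by rewrite mulrS lattice_sndD IHn; lia.
Qed.
Lemma lattice_fstMz (P : lattice) z : (P *~ z).1 = P.1 * z.
Proof.
case: z => n; first exact: lattice_fstMn.
have -> : (P *~ Negz n).1 = - (P *+ n.+1).1 by [].
by rewrite lattice_fstMn; lia.
Qed.
Lemma lattice_sndMz (P : lattice) z : (P *~ z).2 = P.2 * z.
Proof.
case: z => n; first exact: lattice_sndMn.
have -> : (P *~ Negz n).2 = - (P *+ n.+1).2 by [].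
by rewrite lattice_sndMn; lia.
Qed.
Lemma lattice_fstN (P : lattice) : (- P).1 = - P.1. Proof. by []. Qed.
Lemma lattice_sndN (P : lattice) : (- P).2 = - P.2. Proof. by []. Qed.
Definition latE :=
  (lattice_fstD, lattice_sndD, lattice_fstMn, lattice_sndMn, lattice_fstMz, lattice_sndMz, lattice_fstN, lattice_sndN).

Lemma lattice_eqP (P Q : lattice) : P.1 = Q.1 -> P.2 = Q.2 -> P = Q.
Proof. by case: P Q => [a b] [c d] /= -> ->. Qed.

Lemma dv_opp d : dv (opp d) = - dv d.
Proof. by apply: lattice_eqP; case: d. Qed.
Lemma dv_inj : injective dv. Proof. by case=> [] []. Qed.
Lemma dv_neq0 d : dv d != 0. Proof. by case: d. Qed.
Lemma dvK P d : P + dv d + dv (opp d) = P.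
Proof. by rewrite dv_opp addrK. Qed.

Section LatticePoints.
Variable R : realType.

Lemma sqrt3_sq : (Num.sqrt 3 : R) ^+ 2 = 3.
Proof. by rewrite sqr_sqrtr. Qed.

Lemma sqrt3_gt0 : 0 < (Num.sqrt 3 : R).
Proof. by rewrite sqrtr_gt0. Qed.

Lemma pt_fst P : (pt R P).1 = - (P.1%:~R / 2) + P.2%:~R.
Proof.
have -> : (pt R P).1 = P.1%:~R * - 2^-1 + P.2%:~R * 1 by [].
by field.
Qed.

Lemma pt_snd P : (pt R P).2 = - (P.1%:~R * (Num.sqrt 3 / 2)).
Proof.
have -> : (pt R P).2 = P.1%:~R * - (Num.sqrt 3 / 2) + P.2%:~R * 0 by [].
by field.
Qed.

Lemma ptD P Q : pt R (P + Q) = pt R P + pt R Q.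
Proof.
have E (x y : plane R) : x.1 = y.1 -> x.2 = y.2 -> x = y.
  by case: x y => [a b] [c d] /= -> ->.
apply: E.
  have -> : (pt R P + pt R Q).1 = (pt R P).1 + (pt R Q).1 by [].
  by rewrite !pt_fst !latE !intrD; field.
have -> : (pt R P + pt R Q).2 = (pt R P).2 + (pt R Q).2 by [].
by rewrite !pt_snd !latE !intrD; field.
Qed.

Lemma pt_inj : injective (pt R).
Proof.
move=> P Q E.
have := congr1 fst E; have := congr1 snd E; rewrite !pt_snd !pt_fst.
move=> /oppr_inj /mulIf H; have /intr_inj E1 : P.1%:~R = Q.1%:~R :> R.
  by apply: H; rewrite mulf_neq0 ?invr_neq0 ?pnatr_eq0 // gt_eqF // sqrt3_gt0.
by rewrite E1 => /addrI /intr_inj; apply: lattice_eqP.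
Qed.

Lemma eucl_dist_pt P Q :
  eucl_dist (pt R P) (pt R Q) =
  Num.sqrt (((Q.1 - P.1) ^+ 2 - (Q.1 - P.1) * (Q.2 - P.2) + (Q.2 - P.2) ^+ 2)%:~R).
Proof.
rewrite /eucl_dist !pt_fst !pt_snd; congr Num.sqrt.
have := sqrt3_sq; set s := Num.sqrt 3 => E.
rewrite !rmorphD !rmorphN !rmorphXn !rmorphM /= !rmorphB /=.
set a := P.1%:~R; set b := P.2%:~R; set c := Q.1%:~R; set d := Q.2%:~R.
have -> : (- (a * (s / 2)) - - (c * (s / 2))) ^+ 2 = (c - a) ^+ 2 * (s ^+ 2) / 4 by field.
by rewrite E; field.
Qed.

(** The squared length of [x u + y v] is [x ^ 2 - x y + y ^ 2]; for integers this equals 1 only at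
    the six directions. *)
Lemma small_edgeP P Q : small_edge R P Q <-> exists d, Q = P + dv d.
Proof.
rewrite /small_edge eucl_dist_pt; split; last first.
  case=> d ->.
  have -> : (P + dv d).1 - P.1 = (dv d).1 by rewrite latE addrAC subrr add0r.
  have -> : (P + dv d).2 - P.2 = (dv d).2 by rewrite latE addrAC subrr add0r.
  by rewrite -[RHS]sqrtr1; congr Num.sqrt; rewrite -[1]/(1%:~R); congr _%:~R; case: d.
move=> /(congr1 (fun x => x ^+ 2)); rewrite sqr_sqrtr; last first.
  rewrite ler0z; move: (Q.1 - P.1) (Q.2 - P.2) => x y.
  (* Four times the form is [(2 x - y) ^ 2 + 3 y ^ 2]. *)
  by have := sqr_ge0 (x *+ 2 - y); have := sqr_ge0 y; rewrite !expr2; nia.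
rewrite expr1n -[1]/(1%:~R) => /intr_inj E.
have H (d : dir) : Q.1 - P.1 = (dv d).1 -> Q.2 - P.2 = (dv d).2 -> exists d, Q = P + dv d.
  by move=> E1 E2; exists d; apply: lattice_eqP; rewrite !latE -?E1 -?E2; lia.
move: E H; set x := Q.1 - P.1; set y := Q.2 - P.2 => E H.
have x3 : x = -1 \/ x = 0 \/ x = 1 by nia.
have y3 : y = -1 \/ y = 0 \/ y = 1 by nia.
case: x3 => [|[]] Ex; case: y3 => [|[]] Ey; rewrite Ex Ey in E H => //.
- exact: (H dW).
- exact: (H dNU).
- exact: (H dNV).
- exact: (H dV).
- exact: (H dU).
- exact: (H dNW).
Qed.

End LatticePoints.

Section Exits.
Variable r : nat.

Lemma ptAE j : ptA j = (j%:Z, 0).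
Proof. by apply: lattice_eqP; rewrite !latE /=; lia. Qed.
Lemma ptBE j : ptB r j = (r%:Z, j%:Z).
Proof. by apply: lattice_eqP; rewrite !latE /=; lia. Qed.
Lemma ptCE j : ptC r j = (r%:Z - j%:Z, r%:Z - j%:Z).
Proof. by apply: lattice_eqP; rewrite !latE /=; lia. Qed.

Definition inside (P : lattice) : bool := (0 <= P.2) && (P.2 <= P.1 <= r%:Z).

(** The point [i u + j v] has barycentric coordinates [1 - i / r], [(i - j) / r], [j / r] with
    respect to the vertices, and [inside] says that these are nonnegative. *)
Lemma triangleP (R : realType) P : (1 <= r)%N ->
  triangle r (pt R P) <-> inside P.
Proof.
move=> r1; have r0 : (0 : R) < r%:R by rewrite ltr0n.
have s0 := sqrt3_gt0 R.
have ptAr : pt R (lu *+ r) = (- (r%:R / 2), - (r%:R * (Num.sqrt 3 / 2))).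
  by rewrite [LHS]surjective_pairing pt_fst pt_snd !latE /= mul0r mul1r addr0.
have ptBr : pt R (lu *+ r + lv *+ r) = (r%:R / 2, - (r%:R * (Num.sqrt 3 / 2))).
  rewrite [LHS]surjective_pairing pt_fst pt_snd !latE /= !mul0r !mul1r addr0 add0r.
  by congr pair; rewrite !pmulrn; field.
have pt0 : pt R 0 = (0, 0).
  by rewrite [LHS]surjective_pairing pt_fst pt_snd /= !mul0r oppr0 addr0.
have coords (a b c : R) : a *: pt R 0 + b *: pt R (lu *+ r) + c *: pt R (lu *+ r + lv *+ r) =
    (- (((b + c) * r%:R) / 2) + c * r%:R, - (((b + c) * r%:R) * (Num.sqrt 3 / 2))).
  have -> (x y z : plane R) : a *: x + b *: y + c *: z =
      (a * x.1 + b * y.1 + c * z.1, a * x.2 + b * y.2 + c * z.2) by [].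
  by rewrite pt0 ptAr ptBr /=; congr pair; field.
split.
  case=> a [b [c [a0 b0 c0 abc]]]; rewrite coords => E.
  have := congr1 fst E; have := congr1 snd E; rewrite pt_fst pt_snd /=.
  move=> /oppr_inj /mulIf H; have E1 : P.1%:~R = (b + c) * r%:R :> R.
    by apply: H; rewrite mulf_neq0 ?invr_neq0 ?pnatr_eq0 // gt_eqF.
  rewrite E1 => /addrI E2.
  rewrite /inside -!(ler_int R) E1 E2 -[r%:Z%:~R]/(r%:R); apply/andP; split.
    by apply: mulr_ge0; lra.
  apply/andP; split; first by rewrite ler_pM2r //; lra.
  by rewrite ler_piMl //; lra.
move=> /and3P [h1 h2 h3].
exists (1 - P.1%:~R / r%:R), ((P.1 - P.2)%:~R / r%:R), (P.2%:~R / r%:R).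
rewrite subr_ge0 !divr_ge0 ?ler0z ?subr_ge0 ?(ltW r0) //; split => //.
- by rewrite ler_pdivrMr // mul1r -[r%:R]/(r%:Z%:~R) ler_int.
- by rewrite intrD intrN; field; rewrite gt_eqF.
rewrite coords [LHS]surjective_pairing pt_fst pt_snd intrD intrN.
by congr pair; field; rewrite gt_eqF.
Qed.

End Exits.

(** * Measures outside the triangle *)

Section Confined.
Variables (R : realType) (r : nat).
Implicit Types (m : density R) (P : lattice).

Definition mu m P d : R := m P (P + dv d).

(** Consequences of membership in [in_M], read by point and direction; the zero measure is included.
    The gates are the edges required to be null: [X_{j+1} = A_j - v], [Y_{j+1} = B_j - w],
    [Z_{j+1} = C_j - u]. *)
Record confined m : Prop := Confined {
  mu_sym : forall P d, mu m (P + dv d) (opp d) = mu m P d;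
  mu_ge0 : forall P d, 0 <= mu m P d;
  mu_turnV : forall P, mu m P dV - mu m P dNV = mu m P dU - mu m P dNU;
  mu_turnW : forall P, mu m P dW - mu m P dNW = mu m P dU - mu m P dNU;
  mu_gateA : forall i : int, 0 <= i <= r%:Z -> mu m (i, 0) dNV = 0;
  mu_gateB : forall i : int, 0 <= i <= r%:Z -> mu m (r%:Z, i) dNW = 0;
  mu_gateC : forall i : int, 0 <= i <= r%:Z -> mu m (i, i) dNU = 0;
  mu_branch : forall P d1 d2 d3, uniq [:: d1; d2; d3] ->
    0 < mu m P d1 -> 0 < mu m P d2 -> 0 < mu m P d3 -> inside r P }.

Lemma branch_pointP m P : branch_point m P <->
  exists d1 d2 d3, [/\ uniq [:: d1; d2; d3], 0 < mu m P d1, 0 < mu m P d2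
    & 0 < mu m P d3].
Proof.
have inj : injective (fun d => P + dv d) by move=> d e /addrI /dv_inj.
split=> [[Q1 [Q2 [Q3 [uQ [e1 p1] [e2 p2] [e3 p3]]]]]|[d1 [d2 [d3 [ud p1 p2 p3]]]]].
  move/small_edgeP: e1 => [d1 E1]; move/small_edgeP: e2 => [d2 E2].
  move/small_edgeP: e3 => [d3 E3]; exists d1, d2, d3.
  by rewrite /mu -E1 -E2 -E3; split=> //; rewrite -(map_inj_uniq inj) /= -E1 -E2 -E3.
exists (P + dv d1), (P + dv d2), (P + dv d3).
split; first by rewrite -[[:: P + _; _; _]]/(map (fun d => P + dv d) [:: d1; d2; d3]) map_inj_uniq.
- by split=> //; apply/small_edgeP; exists d1.
- by split=> //; apply/small_edgeP; exists d2.
- by split=> //; apply/small_edgeP; exists d3.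
Qed.

Lemma lwE : lw = dv dW. Proof. by apply: lattice_eqP. Qed.

Lemma mu_balanced m : balanced m <->
  forall P, mu m P dV - mu m P dNV = mu m P dU - mu m P dNU /\
    mu m P dW - mu m P dNW = mu m P dU - mu m P dNU.
Proof.
split=> H P.
  have := H P; rewrite lwE -[lu]/(dv dU) -[lv]/(dv dV) -!dv_opp /=.
  by case=> E1 E2; split; [rewrite -[LHS]E1|rewrite -[LHS]E2 -[LHS]E1].
have := H P; rewrite lwE -[lu]/(dv dU) -[lv]/(dv dV) -!dv_opp /mu /=.
by case=> E1 E2; rewrite E1 E2.
Qed.

Definition gated m : Prop := forall j, (j <= r)%N ->
  [/\ m (ptA j) (ptX j.+1) = 0, m (ptB r j) (ptY r j.+1) = 0
    & m (ptC r j) (ptZ r j.+1) = 0].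

Lemma gatedP m : gated m <-> forall j, (j <= r)%N ->
  [/\ mu m (ptA j) dNV = 0, mu m (ptB r j) dNW = 0 & mu m (ptC r j) dNU = 0].
Proof.
have EA j : ptX j.+1 = ptA j + dv dNV.
  by rewrite /ptX !ptAE; apply: lattice_eqP; rewrite ?latE /=; lia.
have EB j : ptY r j.+1 = ptB r j + dv dNW.
  by rewrite /ptY !ptBE; apply: lattice_eqP; rewrite ?latE /=; lia.
have EC j : ptZ r j.+1 = ptC r j + dv dNU.
  by rewrite /ptZ !ptCE; apply: lattice_eqP; rewrite ?latE /=; lia.
by split=> H j /H; rewrite EA EB EC.
Qed.

Lemma in_M_gates m : in_M r m -> gated m.
Proof. by case=> _ [->|[]]. Qed.

Lemma in_M_confined m : (1 <= r)%N -> in_M r m -> confined m.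
Proof.
move=> r1 mM; have /gatedP gates := in_M_gates mM.
move: mM => [[sym ge0 _ /mu_balanced bal] H].
split=> //.
- by move=> P d; rewrite /mu dvK sym.
- by move=> P d; apply: ge0.
- by move=> P; case: (bal P).
- by move=> P; case: (bal P).
- case=> [i|//] /andP [_ ir].
  by case: (gates i) => //; rewrite ptAE.
- case=> [i|//] /andP [_ ir].
  by case: (gates i) => //; rewrite ptBE.
- move=> i /andP [i0 ir].
  have [j Ej] : exists j : nat, i = r%:Z - j%:Z /\ (j <= r)%N.
    by exists (absz (r%:Z - i)); lia.
  by case: Ej => -> jr; case: (gates j) => // _ _; rewrite ptCE.
- move=> P d1 d2 d3 ud p1 p2 p3.
  have bP : branch_point m P by apply/branch_pointP; exists d1, d2, d3.
  case: H => [m0|[_ /(_ P bP) HP _]]; last exact/(triangleP R P r1).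
  by move: p1; rewrite m0 ltxx.
Qed.

Lemma alphaE m j : alpha m j = mu m (j%:Z, 0) dW.
Proof. by rewrite /alpha /ptX lwE ptAE. Qed.
Lemma betaE m j : beta r m j = mu m (r%:Z, j%:Z) dU.
Proof. by rewrite /beta /ptY -[lu]/(dv dU) ptBE. Qed.
Lemma gammaE m j : gamma r m j = mu m (r%:Z - j%:Z, r%:Z - j%:Z) dV.
Proof. by rewrite /gamma /ptZ -[lv]/(dv dV) ptCE. Qed.

Section Outside.
Variable m : density R.
Hypothesis mC : confined m.

(** Balance makes the three differences between opposite densities equal. If they were not 0, three
    edges at [P] would carry mass. *)
Lemma mu_unbranched P d : ~ branch_point m P -> mu m P (opp d) = mu m P d.
Proof.
move=> /branch_pointP nP; have E1 := mu_turnV mC P; have E2 := mu_turnW mC P.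
have ge0 := mu_ge0 mC P.
have E : mu m P dU = mu m P dNU.
  have [lt|gt|//] := ltgtP (mu m P dU) (mu m P dNU); case: nP.
    exists dNU, dNV, dNW; split=> //; first exact: le_lt_trans lt.
      by have := ge0 dV; lra.
    by have := ge0 dW; lra.
  exists dU, dV, dW; split=> //; first exact: le_lt_trans gt.
    by have := ge0 dNV; lra.
  by have := ge0 dNW; lra.
by case: d => /=; lra.
Qed.

Lemma mu_straight P d : ~~ inside r P -> mu m P (opp d) = mu m P d.
Proof.
move=> nP; apply: mu_unbranched => /branch_pointP [d1 [d2 [d3 [ud p1 p2 p3]]]].
case/negP: nP; exact: (mu_branch mC ud p1 p2 p3).
Qed.

Lemma mu_two_dirs P d e : ~~ inside r P -> 0 < mu m P d -> 0 < mu m P e ->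
  e = d \/ e = opp d.
Proof.
move=> nP pd pe; have [->|ned] := eqVneq e d; first by left.
have [->|neo] := eqVneq e (opp d); first by right.
have po : 0 < mu m P (opp d) by rewrite mu_straight.
case/negP: nP; apply: (@mu_branch _ mC P d (opp d) e) => //.
by rewrite /= !inE negb_or ![_ == e]eq_sym ned neo eq_sym opp_neq.
Qed.

Lemma mu_propagate P d n :
  (forall k, (0 < k <= n)%N -> ~~ inside r (P + dv d *+ k)) ->
  mu m (P + dv d *+ n) d = mu m P d.
Proof.
elim: n => [|n IHn] H; first by rewrite mulr0n addr0.
rewrite -IHn; last by move=> k /andP [k0 kn]; apply: H; rewrite k0 leqW.
rewrite mulrSr addrA -(mu_sym mC (P + _)) mu_straight //.
by rewrite -addrA -mulrSr; apply: H; rewrite /= leqnn.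
Qed.

(* The number of edges to cross before leaving the triangle through the side
   whose outgoing rays have direction [e]. *)
Definition height e P : int :=
  match e with dW => P.2 | dU => r%:Z - P.1 | _ => P.1 - P.2 end.

(** Both [e] and [rot e] lower the height by one. Mass arriving at the next point must, by balance
    and positivity, continue along [e] or [rot e]; at height 0 the gate forbids [rot e], so it
    leaves along [e]. *)
Lemma exit_descent e P : outward e -> inside r P ->
  (0 < mu m P e) || (0 < mu m P (rot e)) ->
  exists Q, [/\ inside r Q, height e Q = 0 & 0 < mu m Q e].
Proof.
move=> oe; have [n] := ubnP (absz (height e P)).
elim: n P => // n IHn P hn iP pos.
have [h0|h0] := eqVneq (height e P) 0.
  have rot0 : mu m P (rot e) = 0.
    move: iP h0; rewrite /inside; case: P {hn pos IHn} => i j /=.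
    case: e oe => //= _ iP h0.
    - have -> : j = i by lia.
      by apply: (mu_gateC mC); lia.
    - by rewrite h0; apply: (mu_gateA mC); lia.
    - have -> : i = r%:Z by lia.
      by apply: (mu_gateB mC); lia.
  by exists P; split=> //; move: pos; rewrite rot0 ltxx orbF.
have step d : d = e \/ d = rot e -> 0 < mu m P d ->
    exists Q, [/\ inside r Q, height e Q = 0 & 0 < mu m Q e].
  move=> de pd; apply: (IHn (P + dv d)).
  - by move: iP h0 hn; rewrite /inside; case: P {pos pd IHn} => i j /=;
      case: de => -> {d}; case: e oe => //= _; rewrite ?latE /=; lia.
  - by move: iP h0 hn; rewrite /inside; case: P {pos pd IHn} => i j /=;
      case: de => -> {d}; case: e oe => //= _; rewrite ?latE /=; lia.
  have E1 := mu_turnV mC (P + dv d); have E2 := mu_turnW mC (P + dv d).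
  have ge0 := mu_ge0 mC (P + dv d).
  rewrite -(mu_sym mC P) in pd.
  apply: contraT => /norP [n1 n2].
  suff : mu m (P + dv d) (opp d) <= 0 by rewrite leNgt pd.
  have {}n1 : mu m (P + dv d) e = 0 by apply/eqP; rewrite eq_le ge0 andbT leNgt.
  have {}n2 : mu m (P + dv d) (rot e) = 0 by apply/eqP; rewrite eq_le ge0 andbT leNgt.
  move: (P + dv d) E1 E2 ge0 n1 n2 {pd} => Q E1 E2 ge0.
  have := ge0 dV; have := ge0 dNV; have := ge0 dU; have := ge0 dNU.
  have := ge0 dW; have := ge0 dNW.
  by move: E1 E2; clear -oe de; case: de => -> {d}; case: e oe => //= _; lra.
by case/orP: pos => pd; [apply: (step e)|apply: (step (rot e))]; auto.
Qed.

(** If [e] and [rot e] carried no mass at a branch point, balance would leave only the line of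
    direction [rot (rot e)], with two edges. Hence the descent can start, and each side of the
    triangle has an exit with positive density. *)
Lemma exit_exists e : outward e ->
  (exists P, branch_point m P) ->
  exists Q, [/\ inside r Q, height e Q = 0 & 0 < mu m Q e].
Proof.
move=> oe [P /branch_pointP [d1 [d2 [d3 [ud p1 p2 p3]]]]].
have iP := mu_branch mC ud p1 p2 p3.
apply: (exit_descent oe iP); apply: contraT => /norP [n1 n2].
have E1 := mu_turnV mC P; have E2 := mu_turnW mC P.
have ge0 := mu_ge0 mC P.
have {}n1 : mu m P e = 0 by apply/eqP; rewrite eq_le ge0 andbT leNgt.
have {}n2 : mu m P (rot e) = 0 by apply/eqP; rewrite eq_le ge0 andbT leNgt.
have Z d : (0 < mu m P d) -> (d == rot (rot e)) || (d == opp (rot (rot e))).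
  have := ge0 dV; have := ge0 dNV; have := ge0 dU; have := ge0 dNU.
  have := ge0 dW; have := ge0 dNW.
  by move: n1 n2; case: e oe => //= _; case: d => //= *; exfalso; lra.
move: (Z _ p1) (Z _ p2) (Z _ p3) ud; case: e oe {n1 n2 Z} => //= _;
  by case: d1 {p1} => //=; case: d2 {p2} => //=; case: d3 {p3}.
Qed.

End Outside.
End Confined.

(** * Exit rays, and the support of a measure outside the triangle *)

Section Rays.
Variables (R : realType) (r : nat).
Implicit Types (m : density R) (P Q : lattice).

Definition ray e P : bool :=
  match e with
  | dW => (P.2 < 0) && (0 <= P.1 - P.2 <= r%:Z)
  | dU => (r%:Z < P.1) && (0 <= P.2 <= r%:Z)
  | _ => (0 <= P.1 <= r%:Z) && (P.1 < P.2)
  end.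

Lemma rayP e P : outward e -> ray e P ->
  exists Q n, [/\ inside r Q, height r e Q = 0 & P = Q + dv e *+ n.+1].
Proof.
case: e => // _ /=; rewrite /inside => H.
- exists (P.1, P.1), (absz (P.2 - P.1)%R).-1; split; rewrite /= ?subrr //; first by lia.
  by apply: lattice_eqP; rewrite ?latE /=; lia.
- exists (P.1 - P.2, 0), (absz P.2).-1; split; rewrite //=; first by lia.
  by apply: lattice_eqP; rewrite ?latE /=; lia.
- exists (r%:Z, P.2), (absz (P.1 - r%:Z)%R).-1; split; rewrite /= ?subrr //; first by lia.
  by apply: lattice_eqP; rewrite ?latE /=; lia.
Qed.

Lemma ray_outside e P : ray e P -> ~~ inside r P.
Proof. by case: e; rewrite /inside /=; lia. Qed.

Lemma ray_inj e f P : outward e -> outward f -> ray e P -> ray f P -> e = f.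
Proof. by case: e => //; case: f => //= _ _; lia. Qed.

Section OneMeasure.
Variable m : density R.
Hypothesis mC : confined r m.

Lemma exit_ray e Q n : outward e -> inside r Q -> height r e Q = 0 ->
  mu m (Q + dv e *+ n) e = mu m Q e.
Proof.
move=> oe iQ hQ; apply: (mu_propagate mC) => k /andP [k0 _].
by move: iQ hQ; rewrite /inside; case: e oe => //= _; rewrite ?latE /=; lia.
Qed.

Lemma line_pos e P z : (forall k : int, ~~ inside r (P + dv e *~ k)) ->
  0 < mu m P e -> 0 < mu m (P + dv e *~ z) e.
Proof.
move=> nP pe; case: z => n.
  rewrite (mu_propagate mC) // => k _; exact: (nP k).
have E k : dv e *~ Negz k = dv (opp e) *+ k.+1 by rewrite dv_opp mulNrn.
rewrite -(mu_straight mC _ (nP _)) E (mu_propagate mC).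
  by rewrite (mu_straight mC) //; have := nP 0; rewrite mulr0z addr0.
by case=> // k _; rewrite -E.
Qed.

Lemma no_crossing e f P Q z : f != e -> f != opp e ->
  (forall k : int, ~~ inside r (P + dv e *~ k)) ->
  0 < mu m P e -> 0 < mu m Q f -> Q = P + dv e *~ z -> False.
Proof.
move=> fe fo nP pe pf EQ.
have := line_pos z nP pe; rewrite -EQ => pQ.
have nQ : ~~ inside r Q by rewrite EQ.
by case: (mu_two_dirs mC nQ pQ pf) => E; [move: fe|move: fo]; rewrite E eqxx.
Qed.

Hypothesis mB : exists P, branch_point m P.

Lemma exit_far f : outward f -> exists Q,
  [/\ inside r Q, height r f Q = 0 &
      forall n : nat, 0 < mu m (Q + dv f *+ n) f].
Proof.
move=> of_; have [Q [iQ hQ pQ]] := exit_exists mC of_ mB.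
by exists Q; split=> // k; rewrite exit_ray.
Qed.

(** A supported line that misses the triangle would cross an exit ray of direction [f], which exists
    because [m] has a branch point. The crossing lies outside the triangle, where the support has
    only one direction. *)
Lemma crossing_far e f P : f != e -> f != opp e -> outward f ->
  (forall k : int, ~~ inside r (P + dv e *~ k)) -> 0 < mu m P e ->
  (forall Q, inside r Q -> height r f Q = 0 ->
     exists (n : nat) (z : int), Q + dv f *+ n = P + dv e *~ z) -> False.
Proof.
move=> fe fo of_ nP pe H.
have [Q [iQ hQ pQ]] := exit_far of_.
by have [n [z E]] := H Q iQ hQ; apply: (no_crossing fe fo nP pe (pQ n) E).
Qed.

(** Off the exit rays there are two cases. Either the line through [P] misses the triangle and
    [crossing_far] applies, or following [e] from [P] reaches the triangle at a point whose edge
    back along the line is a gate, so the density is 0. *)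
Lemma outside_axis P e : outward e -> ~~ inside r P ->
  0 < mu m P e -> 0 < mu m P (opp e) -> ray e P.
Proof.
move=> oe nP pe po; apply: contraT => nr.
(* [n] is the number of steps from [P] to the triangle; the density is constant along them, so the
   null gate at the end contradicts [pe]. *)
have enter n : (forall k, (k < n)%N -> ~~ inside r (P + dv e *+ k)) ->
    mu m (P + dv e *+ n) (opp e) = 0 -> ray e P.
  case: n => [_|n nk]; first by rewrite addr0 => E; move: po; rewrite E ltxx.
  rewrite mulrSr addrA (mu_sym mC) (mu_propagate mC) => [E|k /andP [_ kn]].
    by move: pe; rewrite E ltxx.
  exact: nk.
case: P nP pe po nr enter => i j; case: e oe => //= _ nP pe po nr enter; exfalso.
- case: (ltrP i 0) => i0.
    apply: (crossing_far (e := dV) (f := dW) _ _ _ _ pe) => //.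
      by move=> k; rewrite /inside !latE /=; lia.
    move=> Q; rewrite /inside /= => iQ hQ; exists (absz (Q.1 - i)%R), (i - Q.1 - j).
    by apply: lattice_eqP; rewrite !latE /=; lia.
  case: (ltrP r%:Z i) => ir.
    apply: (crossing_far (e := dV) (f := dU) _ _ _ _ pe) => //.
      by move=> k; rewrite /inside !latE /=; lia.
    move=> Q; rewrite /inside /= => iQ hQ; exists (absz (i - r%:Z)%R), (Q.2 - j).
    by apply: lattice_eqP; rewrite !latE /=; lia.
  case/negP: (nr); apply: (enter (absz j)).
    by move=> k kj; move: nP nr; rewrite /inside !latE /=; lia.
  have -> : (i, j) + dv dV *+ (absz j) = (i, 0) :> lattice.
    by apply: lattice_eqP; rewrite !latE /=; move: nP nr; rewrite /inside /=; lia.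
  by apply: (mu_gateA mC); lia.
- case: (ltrP (i - j) 0) => i0.
    apply: (crossing_far (e := dW) (f := dV) _ _ _ _ pe) => //.
      by move=> k; rewrite /inside !latE /=; lia.
    move=> Q; rewrite /inside /= => iQ hQ; exists (absz (i - j)%R), (i - Q.1).
    by apply: lattice_eqP; rewrite !latE /=; lia.
  case: (ltrP r%:Z (i - j)) => ir.
    apply: (crossing_far (e := dW) (f := dU) _ _ _ _ pe) => //.
      by move=> k; rewrite /inside !latE /=; lia.
    move=> Q; rewrite /inside /= => iQ hQ; exists (absz (i - j + Q.2 - r%:Z)%R), (j - Q.2).
    by apply: lattice_eqP; rewrite !latE /=; lia.
  case/negP: (nr); apply: (enter (absz (i - r%:Z)%R)).
    by move=> k kj; move: nP nr; rewrite /inside !latE /=; lia.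
  have -> : (i, j) + dv dW *+ (absz (i - r%:Z)%R) = (r%:Z, r%:Z - (i - j)) :> lattice.
    by apply: lattice_eqP; rewrite !latE /=; move: nP nr; rewrite /inside /=; lia.
  by apply: (mu_gateB mC); lia.
- case: (ltrP j 0) => i0.
    apply: (crossing_far (e := dU) (f := dW) _ _ _ _ pe) => //.
      by move=> k; rewrite /inside !latE /=; lia.
    move=> Q; rewrite /inside /= => iQ hQ; exists (absz j), (Q.1 + j - i).
    by apply: lattice_eqP; rewrite !latE /=; lia.
  case: (ltrP r%:Z j) => ir.
    apply: (crossing_far (e := dU) (f := dV) _ _ _ _ pe) => //.
      by move=> k; rewrite /inside !latE /=; lia.
    move=> Q; rewrite /inside /= => iQ hQ; exists (absz (j - Q.2)%R), (Q.1 - i).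
    by apply: lattice_eqP; rewrite !latE /=; lia.
  case/negP: (nr); apply: (enter (absz (j - i)%R)).
    by move=> k kj; move: nP nr; rewrite /inside !latE /=; lia.
  have -> : (i, j) + dv dU *+ (absz (j - i)%R) = (j, j) :> lattice.
    by apply: lattice_eqP; rewrite !latE /=; move: nP nr; rewrite /inside /=; lia.
  by apply: (mu_gateC mC); lia.
Qed.

Lemma outside_ray P d : ~~ inside r P -> 0 < mu m P d ->
  exists e, [/\ outward e, ray e P & d = e \/ d = opp e].
Proof.
move=> nP pd; have po : 0 < mu m P (opp d) by rewrite (mu_straight mC).
have [od|od] := boolP (outward d).
  by exists d; split=> //; [exact: outside_axis|left].
exists (opp d); rewrite outward_opp od oppK; split=> //; last by right.
by apply: outside_axis; rewrite ?outward_opp // oppK.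
Qed.

End OneMeasure.
End Rays.

(** * Sigma as a sum over lattice points *)

Section SigmaLocal.
Variables (R : realType) (r : nat).
Implicit Types (m : density R) (P Q : lattice).

(** The form in which membership in [in_M] enters the summation; unlike the argument with branch
    points, it covers the zero measure as well. *)
Record tame m : Prop := Tame {
  tame_confined :> confined r m;
  tame_outside : forall P d, ~~ inside r P -> 0 < mu m P d ->
    exists e, [/\ outward e, ray r e P & d = e \/ d = opp e] }.

Lemma in_M_tame m : (1 <= r)%N -> in_M r m -> tame m.
Proof.
move=> r1 mM; have mC := in_M_confined r1 mM; split=> // P d nP pd.
case: mM => _ [m0|[mB _ _]]; first by move: pd; rewrite m0 ltxx.
exact: (outside_ray mC mB).
Qed.

Lemma tame_eq0 m P d : tame m -> ~~ inside r P ->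
  (forall e, outward e -> ray r e P -> d != e /\ d != opp e) -> mu m P d = 0.
Proof.
move=> mT nP H; apply/eqP; rewrite eq_le (mu_ge0 mT) andbT leNgt.
apply/negP => /(tame_outside mT nP) [e [oe re de]].
by have [n1 n2] := H e oe re; case: de => de; [move: n1|move: n2]; rewrite de eqxx.
Qed.

Definition sq (i j : nat) : lattice := (i%:Z, j%:Z).

(** The square consists of the triangle and of the half above the diagonal, where only the rays of
    direction [v] from the [C_j] carry mass. The boundary conditions come from the gates and from
    this description of the support. *)
Lemma tame_square m : tame m ->
  square_flow r (fun i j => mu m (sq i j) dNU) (fun i j => mu m (sq i j) dNV)
    (fun i j => mu m (sq i j) dW).
Proof.
move=> mT.
have EU i j : mu m (sq i.+1 j) dNU = mu m (sq i j) dU.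
  by rewrite -(mu_sym mT); congr (mu m _ _); apply: lattice_eqP; rewrite ?latE /=; lia.
have EV i j : mu m (sq i j.+1) dNV = mu m (sq i j) dV.
  by rewrite -(mu_sym mT); congr (mu m _ _); apply: lattice_eqP; rewrite ?latE /=; lia.
have EW i j : mu m (sq i.+1 j.+1) dW = mu m (sq i j) dNW.
  by rewrite -(mu_sym mT); congr (mu m _ _); apply: lattice_eqP; rewrite ?latE /=; lia.
split=> [i j _ _|i j _ _|j jr|i ir|j jr|j jr|i ir].
- by rewrite EU EV (mu_turnV mT).
- by rewrite EU EW -(mu_turnW mT) opprB addrC subrK.
- case: j jr => [|j] jr; first by apply: (mu_gateC mT).
  by apply: (tame_eq0 mT); [rewrite /inside /=; lia|case=> //= _; lia].
- by apply: (mu_gateA mT); lia.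
- by apply: (tame_eq0 mT); [rewrite /inside /=; lia|case=> //= _; lia].
- by rewrite EW; apply: (mu_gateB mT); lia.
- rewrite EW; move: ir; rewrite leq_eqVlt => /orP [/eqP ->|ir].
    by apply: (mu_gateB mT); lia.
  by apply: (tame_eq0 mT); [rewrite /inside /=; lia|case=> //= _; lia].
Qed.

Lemma exit_beta m j : tame m -> mu m (sq r.+1 j) dNU = beta r m j.
Proof.
move=> mT; rewrite betaE -(mu_sym mT); congr (mu m _ _).
by apply: lattice_eqP; rewrite ?latE /=; lia.
Qed.

(** The mass at the top of column [i] has travelled along the ray from the diagonal point [(i, i)],
    which is [C_j] for [j = r - i]. *)
Lemma exit_gamma m i : tame m -> (i <= r)%N ->
  mu m (sq i r.+1) dNV = gamma r m (r - i).
Proof.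
move=> mT ir; rewrite gammaE.
transitivity (mu m (sq i r) dV).
  by rewrite -(mu_sym mT); congr (mu m _ _); apply: lattice_eqP; rewrite ?latE /=; lia.
have -> : sq i r = (r%:Z - (r - i)%:Z, r%:Z - (r - i)%:Z) + dv dV *+ (r - i).
  by apply: lattice_eqP; rewrite ?latE /=; lia.
by rewrite (exit_ray mT) //; rewrite /inside /=; lia.
Qed.

(** The summand of [sum_flow_pairing], with all densities read at the single point [P]. *)
Definition pairing m m' P : R :=
  mu m' P dNU * mu m P dNV + mu m' P dNV * mu m P dNW + mu m' P dNW * mu m P dNU
  - (mu m P dU - mu m P dNU) * (mu m' P dU - mu m' P dNU).

Lemma sum_tail (n i : nat) (f : nat -> R) : (i <= n)%N ->
  \sum_(k < n) f k - \sum_(k < i) f k = \sum_(k < n | (i <= k)%N) f k.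
Proof.
move=> im; rewrite (bigID (fun k : 'I_n => (k < i)%N)) /= -big_ord_widen //.
by rewrite addrAC subrr add0r; apply: eq_bigl => k; rewrite -leqNgt.
Qed.

Lemma Sigma_pairing m m' : tame m -> tame m' ->
  Sigma r m' m = \sum_(i < r.+1) \sum_(j < r.+1) pairing m m' (sq i j).
Proof.
move=> mT mT'; have F := tame_square mT; have F' := tame_square mT'.
have EU m1 i j : tame m1 -> mu m1 (sq i j) dU = mu m1 (sq i.+1 j) dNU.
  move=> T1; rewrite -(mu_sym T1); congr (mu m1 _ _).
  by apply: lattice_eqP; rewrite ?latE /=; lia.
have EW m1 i j : tame m1 -> mu m1 (sq i j) dNW = mu m1 (sq i.+1 j.+1) dW.
  move=> T1; rewrite -(mu_sym T1); congr (mu m1 _ _).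
  by apply: lattice_eqP; rewrite ?latE /=; lia.
transitivity (\sum_(i < r.+1) \sum_(j < r.+1)
   (mu m' (sq i j) dNU * mu m (sq i j) dNV
    + mu m' (sq i j) dNV * mu m (sq i.+1 j.+1) dW
    + mu m' (sq i.+1 j.+1) dW * mu m (sq i j) dNU
    - (mu m (sq i.+1 j) dNU - mu m (sq i j) dNU)
      * (mu m' (sq i.+1 j) dNU - mu m' (sq i j) dNU))); last first.
  by apply: eq_bigr => i _; apply: eq_bigr => j _; rewrite /pairing !EU // !EW.
rewrite (sum_flow_pairing F F') /Sigma.
have EA m1 k : mu m1 (sq k 0) dW = alpha m1 k by rewrite alphaE.
have Ew m1 : \sum_(k < r.+1) mu m1 (sq k 0) dW = weight r m1.
  by apply: eq_bigr => k _; rewrite EA.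
have tail (f : nat -> R) (i : 'I_r.+1) : \sum_(k < r.+1) f k - \sum_(k < i.+1) f k =
    \sum_(k < r.+1 | (i < k)%N) f k by rewrite sum_tail.
rewrite !Ew; congr (_ - _); under eq_bigr do rewrite big_split /= big_split /=.
rewrite !big_split /=; congr (_ + _ + _); apply/esym.
- apply: eq_bigr => i _; rewrite EA -Ew (tail (fun k => mu m' (sq k 0) dW)).
  by rewrite mulr_suml; apply: eq_bigr => k _; rewrite EA mulrC.
- apply: eq_bigr => i _; rewrite exit_beta // -Ew -(sum_exit_a F').
  rewrite (tail (fun k => mu m' (sq r.+1 k) dNU)) mulr_suml.
  by apply: eq_bigr => k _; rewrite exit_beta // mulrC.
(* Columns and [gamma] exits are numbered in opposite orders; reversing both indices turns the
   initial sums into the tails that occur in [Sigma]. *)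
- rewrite (reindex_inj rev_ord_inj) /=; apply: eq_bigr => i _.
  have ir : (i <= r)%N by rewrite -ltnS.
  rewrite subSS exit_gamma ?leq_subr // subKn // -mulr_sumr mulrC; congr (_ * _).
  rewrite (big_ord_widen r.+1 (fun k => mu m' (sq k r.+1) dNV)); last by lia.
  rewrite (reindex_inj rev_ord_inj) /=; apply: eq_big => k.
    by have := ltn_ord k; lia.
  by rewrite subSS => _; rewrite exit_gamma ?leq_subr // subKn // -ltnS.
Qed.

End SigmaLocal.

(** * Trees immersed in the lattice *)

Section Words.
Implicit Types (s t : seq dir) (d e : dir).

Definition noback d e := e != opp d.
Definition reduced s := sorted noback s.
Definition inv s := rev (map opp s).

Lemma reduced_rcons d s : reduced (rcons s d) ->
  reduced s /\ (s != [::] -> d != opp (last d s)).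
Proof.
case: s => [//|e s]; rewrite /reduced /= rcons_path => /andP [-> H].
by split=> // _.
Qed.

Lemma rcons_reduced d e s : reduced s -> d != opp (last e s) ->
  reduced (rcons s d).
Proof.
by case: s => [//|f s]; rewrite /reduced /= rcons_path => -> H.
Qed.

Lemma reduced_cons d s : reduced (d :: s) -> reduced s.
Proof. exact: path_sorted. Qed.

Lemma reduced_inv s : reduced s -> reduced (inv s).
Proof.
rewrite /reduced /inv rev_sorted sorted_map.
apply: sub_sorted => d e; rewrite /noback /=.
by case: d; case: e.
Qed.

Lemma invK : involutive inv.
Proof. by move=> s; rewrite /inv map_rev revK mapK //; exact: oppK. Qed.

Lemma reduced_cat s d e t : reduced (rcons s d) -> reduced (e :: t) ->
  noback d e -> reduced (rcons s d ++ e :: t).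
Proof.
case: s => [|f s] /=; rewrite /reduced /=; first by move=> _ -> ->.
by rewrite cat_path last_rcons /= => -> -> ->.
Qed.

Lemma reduced_catl s t : reduced (s ++ t) -> reduced s.
Proof. by case: s => [//|d s]; rewrite /reduced /= cat_path => /andP []. Qed.

Lemma reduced_catr s t : reduced (s ++ t) -> reduced t.
Proof.
elim: s => [//|d s IHs] /= H; apply: IHs; exact: reduced_cons H.
Qed.

(** Conjugation as in a free group: while the last letter is opposite to the first, the pair is
    moved into [g] and its inverse. A reduced word cannot disappear entirely in this way. *)
Lemma cyclic_reduction s : reduced s -> s != [::] ->
  exists g c, [/\ s = g ++ c ++ inv g, c != [::] & reduced (c ++ c)].
Proof.
have [n] := ubnP (size s); elim: n s => // n IHn [//|d s] sn rs _.
case: (lastP s) sn rs => [|t e] sn rs.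
  by exists [::], [:: d]; split=> //=; rewrite /reduced /= /noback; case: (d).
have [Eed|ned] := eqVneq d (opp e); last first.
  exists [::], (d :: rcons t e); split=> //; first by rewrite /= cats0.
  rewrite -[X in X ++ _]/(rcons (d :: t) e).
  exact: reduced_cat.
have rt : reduced t.
  by move: (reduced_cons rs) => /reduced_rcons [].
have t0 : t != [::].
  by case: t rs {sn rt} => //; rewrite /reduced /= Eed /noback oppK eqxx.
have [|g [c [Et c0 cc]]] := IHn t _ rt t0.
  by move: sn; rewrite /= size_rcons; lia.
exists (d :: g), c; split=> //.
by rewrite Et /inv /= rev_cons -!rcons_cat Eed oppK.
Qed.

Definition power s n := flatten (nseq n s).

Lemma reduced_power g c n : c != [::] -> reduced (g ++ c) -> reduced (c ++ c) ->
  reduced (g ++ power c n).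
Proof.
move=> c0 gc cc; elim: n g gc => [|n IHn] g gc.
  by rewrite cats0; exact: reduced_catl gc.
rewrite /power /= catA; apply: IHn; rewrite -catA.
case: c c0 gc cc => // d c _.
case: (lastP c) => [|t e].
  case: (lastP g) => [//|h f] H1 H2.
  rewrite cat_rcons -cat_rcons.
  have := H1; rewrite cats1 => /reduced_rcons [H3 H4].
  apply: reduced_cat => //.
  by move: H1; rewrite -cats1 -catA => /reduced_catr; rewrite /reduced /= => /andP [].
move=> H1 H2; rewrite catA -[X in (g ++ X) ++ _]/(rcons (d :: t) e) -rcons_cat.
apply: (@reduced_cat _ _ d (rcons t e)).
- by rewrite rcons_cat.
- by move: H1 => /reduced_catr.
- move: H2; rewrite -[X in X ++ _]/(rcons (d :: t) e) -cats1 -catA.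
  by move=> /reduced_catr; rewrite /reduced /= => /andP [].
Qed.

End Words.

Definition rot2 d := rot (rot d).

(* The sets of directions of the edges at a vertex of order 2 or 3. *)
Definition shape (D : pred dir) : Prop :=
  (exists a, D =1 [pred d | d \in [:: a; opp a]]) \/
  (exists a, D =1 [pred d | d \in [:: a; rot2 a; rot2 (rot2 a)]]).

(* The direction that is free at a vertex when all edges but the one in the
   direction [p] are matched. *)
Definition slack (D : pred dir) p := if D (opp p) then rot2 p else opp p.

(** Only two shapes contain [p], the line and the tripod, and the slack direction of each belongs to
    the other. *)
Lemma slack_shape (D E : pred dir) p d : shape D -> shape E -> D p -> E p ->
  D d != E d -> E (slack D p).
Proof.
by case=> [] [a Da] [] [b Eb]; rewrite /slack !Da !Eb;
  case: a Da => _; case: b Eb => _; case: p => //= _ _; case: d.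
Qed.

Lemma shape_straight (D : pred dir) e : shape D ->
  (forall d, D d -> d = e \/ d = opp e) -> D =1 [pred d | d \in [:: e; opp e]].
Proof.
case=> [] [a Da] H.
  have Daa : D a by rewrite Da /= !inE eqxx.
  by case: (H a Daa) Da => -> Da d; rewrite Da //= !inE oppK orbC.
have H1 := H a; have H2 := H (rot2 a); have H3 := H (rot2 (rot2 a)).
move: H1 H2 H3; rewrite !Da /= !inE !eqxx !orbT.
by case: a {Da} => /(_ isT) H1 /(_ isT) H2 /(_ isT) H3; exfalso;
  case: e H1 H2 H3 {H} => /= [] [] // _ [] // _ [].
Qed.

(* A tree immersed in the lattice: [nb x d] is the neighbor of the vertex [x]
   in the direction [d], provided that [dirs x d]. *)
Section WalkDef.
Variables (X : eqType) (dirs : X -> pred dir) (nb : X -> dir -> X).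
Fixpoint valid x s := if s is d :: t then dirs x d && valid (nb x d) t else true.
Definition walk := foldl nb.

Lemma walk_cat x s t : walk x (s ++ t) = walk (walk x s) t.
Proof. exact: foldl_cat. Qed.

Lemma valid_cat x s t : valid x (s ++ t) = valid x s && valid (walk x s) t.
Proof. by elim: s x => [//|d s IHs] x /=; rewrite IHs andbA. Qed.

End WalkDef.

Record lattice_tree (X : eqType) := LatticeTree {
  vx : pred X;
  pos : X -> lattice;
  dirs : X -> pred dir;
  nb : X -> dir -> X;
  fib : lattice -> seq X;
  nb_vx : forall x d, vx x -> dirs x d -> vx (nb x d);
  nb_pos : forall x d, vx x -> dirs x d -> pos (nb x d) = pos x + dv d;
  nb_opp : forall x d, vx x -> dirs x d -> dirs (nb x d) (opp d);
  nbK : forall x d, vx x -> dirs x d -> nb (nb x d) (opp d) = x;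
  dirs_shape : forall x, vx x -> shape (dirs x);
  connected_words : forall x y, vx x -> vx y ->
    exists s, [/\ valid dirs nb x s, reduced s & walk nb x s = y];
  acyclic_words : forall x s, vx x -> valid dirs nb x s -> reduced s ->
    s != [::] -> walk nb x s <> x;
  fib_uniq : forall P, uniq (fib P);
  mem_fib : forall P x, (x \in fib P) = vx x && (pos x == P) }.

(** * Walks in a lattice tree, and the tree rooted at an edge *)

Section LatticeTree.
Variables (X : choiceType) (T : lattice_tree X).
Implicit Types (x y : X) (s t : seq dir) (d e : dir) (P : lattice).

Notation vx := (vx T).
Notation pos := (pos T).
Notation dirs := (dirs T).
Notation nb := (nb T).
Notation valid := (valid dirs nb).
Notation walk := (walk nb).

Lemma walk_vx x s : vx x -> valid x s -> vx (walk x s).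
Proof.
elim: s x => [//|d s IHs] x vxx /= /andP [dx vs].
by apply: IHs => //; apply: nb_vx.
Qed.

Lemma walk_pos x s : vx x -> valid x s ->
  pos (walk x s) = pos x + \sum_(d <- s) dv d.
Proof.
elim: s x => [|d s IHs] x vxx /=; first by rewrite big_nil addr0.
by move=> /andP [dx vs]; rewrite IHs ?nb_vx // nb_pos // big_cons addrA.
Qed.

Lemma valid_inv x s : vx x -> valid x s ->
  valid (walk x s) (inv s) /\ walk (walk x s) (inv s) = x.
Proof.
elim: s x => [//|d s IHs] x vxx /= /andP [dx vs].
have [v1 w1] := IHs _ (nb_vx vxx dx) vs.
rewrite /inv /= rev_cons -cats1 valid_cat walk_cat -/(inv s) v1 w1 /=.
by rewrite nb_opp // nbK.
Qed.

(** Uniqueness of paths in a tree: once the common prefix is removed, [inv s ++ t] would be a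
    reduced closed walk. *)
Lemma walk_inj x s t : vx x -> valid x s -> valid x t ->
  reduced s -> reduced t -> walk x s = walk x t -> s = t.
Proof.
elim: s x t => [|d s IHs] x [//|e t] vxx.
- by move=> _ vt _ rt /esym E; case: (acyclic_words vxx vt rt _ E).
- by move=> vs _ rs _ E; case: (acyclic_words vxx vs rs _ E).
move=> vs vt rs rt E; have [de|ned] := eqVneq d e.
  move: vs vt E; rewrite -de /= => /andP [dx vs] /andP [_ vt] E; congr (_ :: _).
  apply: (IHs (nb x d)) => //; [exact: nb_vx|exact: reduced_cons rs|].
  exact: reduced_cons rt.
have [vi wi] := valid_inv vxx vs.
case: (acyclic_words (s := inv (d :: s) ++ e :: t) (walk_vx vxx vs)) => //.
- by rewrite valid_cat vi wi.
- rewrite /inv /= rev_cons; apply: reduced_cat => //.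
    by rewrite -rev_cons; exact: (reduced_inv rs).
  by rewrite /noback oppK eq_sym.
- by rewrite /inv /= rev_cons; case: (rev _).
by rewrite walk_cat wi E.
Qed.

Section Rooted.
Variables (x0 : X) (d0 : dir).
Hypotheses (vx0 : vx x0) (dx0 : dirs x0 d0).

Lemma word_ex y : exists s, vx y ==> [&& valid x0 s, reduced s & walk x0 s == y].
Proof.
have [vy|_] := boolP (vx y); last by exists [::].
have [s [a b c]] := connected_words vx0 vy.
by exists s; rewrite a b c eqxx.
Qed.

Definition word y : seq dir := xchoose (word_ex y).

Lemma wordP y : vx y ->
  [/\ valid x0 (word y), reduced (word y) & walk x0 (word y) = y].
Proof.
move=> vy; have /implyP/(_ vy)/and3P [a b /eqP c] := xchooseP (word_ex y).
by split.
Qed.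

Lemma word_walk s : valid x0 s -> reduced s -> word (walk x0 s) = s.
Proof.
move=> vs rs; have [a b c] := wordP (walk_vx vx0 vs).
exact: (walk_inj vx0).
Qed.

Lemma word_root : word x0 = [::].
Proof. exact: (@word_walk [::]). Qed.

(* Both ends of the root edge point to each other. *)
Definition par y := opp (last (opp d0) (word y)).

Lemma par_root : par x0 = d0.
Proof. by rewrite /par word_root /= oppK. Qed.

Lemma word_rcons y : vx y -> y != x0 -> exists s d,
  [/\ word y = rcons s d, valid x0 s, reduced s, walk x0 s = nb y (opp d)
    & dirs (walk x0 s) d /\ y = nb (walk x0 s) d].
Proof.
move=> vy; have [] := wordP vy; case/lastP: (word y) => [|s d] /=.
  by move=> _ _ -> /eqP.
rewrite -cats1 valid_cat walk_cat /= andbT => /andP [vs ds] rs E _.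
exists s, d; split=> //; first by rewrite cats1.
- by move: rs; rewrite cats1 => /reduced_rcons [].
by rewrite -E nbK // walk_vx.
Qed.

Lemma par_dirs y : vx y -> dirs y (par y).
Proof.
move=> vy; have [->|ny] := eqVneq y x0; first by rewrite par_root.
have [s [d [E vs rs _ [ds Ey]]]] := word_rcons vy ny.
by rewrite /par E last_rcons Ey nb_opp // walk_vx.
Qed.

Lemma par_child y d : vx y -> dirs y d -> d != par y ->
  par (nb y d) = opp d /\ nb y d != x0.
Proof.
move=> vy dy nd; have [vw rw ww] := wordP vy.
have Ew : word (nb y d) = rcons (word y) d.
  have -> : nb y d = walk x0 (rcons (word y) d) by rewrite -cats1 walk_cat ww.
  rewrite word_walk //; first by rewrite -cats1 valid_cat vw ww /= dy.
  exact: rcons_reduced rw nd.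
rewrite /par Ew last_rcons; split=> //; apply: contra_eqN Ew => /eqP ->.
by rewrite word_root; case: (word y).
Qed.

(** Passing to the parent drops the last letter of the word. The condition on [par y] excludes the
    far end of the root edge, whose parent points back at it. *)
Lemma par_parent y : vx y -> y != x0 -> par y != opp d0 ->
  par (nb y (par y)) != opp (par y) /\
  (size (word (nb y (par y))) < size (word y))%N.
Proof.
move=> vy ny; have [_ ry _] := wordP vy.
have [s [d [E vs rs W _]]] := word_rcons vy ny.
have Ep : par y = opp d by rewrite /par E last_rcons.
have Ew : word (nb y (par y)) = s by rewrite Ep -W word_walk.
have -> : par (nb y (par y)) = opp (last (opp d0) s) by rewrite /par Ew.
rewrite Ew Ep E oppK size_rcons ltnSn => nd; split=> //.
move: ry; rewrite E; case: (lastP s) nd => [|t e] nd.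
  by rewrite /= oppK => _; apply: contraNneq nd => ->.
rewrite last_rcons => /reduced_rcons [_]; rewrite last_rcons => H.
by rewrite eq_sym; apply: H; case: (t).
Qed.

End Rooted.
End LatticeTree.

(** * Sigma as a sum over the vertices of a tree *)

Definition in_square r (P : lattice) : bool :=
  (0 <= P.1 <= r%:Z) && (0 <= P.2 <= r%:Z).

Definition squares r : seq lattice :=
  [seq sq i j | i <- iota 0 r.+1, j <- iota 0 r.+1].

Lemma mem_squares r P : (P \in squares r) = in_square r P.
Proof.
apply/allpairsP/idP => [[[i j] []]|].
  by rewrite !mem_iota /in_square /sq /= => i1 j1 -> /=; lia.
rewrite /in_square => H; exists (absz P.1, absz P.2).
by rewrite !mem_iota; split=> /=; [lia|lia|apply: lattice_eqP => /=; lia].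
Qed.

Lemma squares_uniq r : uniq (squares r).
Proof.
by apply: allpairs_uniq; rewrite ?iota_uniq // => -[i j] [k l] _ _ /= [-> ->].
Qed.

Lemma inside_square r P : inside r P -> in_square r P.
Proof. by rewrite /inside /in_square; lia. Qed.

Definition inwards := [:: dNU; dNV; dNW].
Definition outwards := [:: dV; dW; dU].

Lemma mem_inwards d : (d \in inwards) = ~~ outward d. Proof. by case: d. Qed.
Lemma mem_outwards d : (d \in outwards) = outward d. Proof. by case: d. Qed.

Section SquareSteps.
Variables (R : realType) (r : nat) (m : density R).
Hypothesis mT : tame r m.

(** An inward edge across the boundary of the square has one of the densities that [square_flow]
    sets to 0. *)
Lemma inward_square P d : ~~ outward d -> in_square r P -> 0 < mu m P d ->
  in_square r (P + dv d).
Proof.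
have F := tame_square mT; move=> od iP pd.
have [i [j [EP ir jr]]] : exists i j, [/\ P = sq i j, (i <= r)%N & (j <= r)%N].
  exists (absz P.1), (absz P.2); move: iP; rewrite /in_square => iP.
  by split; [apply: lattice_eqP => /=|..]; lia.
move: pd; rewrite EP {iP EP}; case: d od => // _ pd.
- case: i ir pd => [|i] ir; first by rewrite (flow_a0 F) // ltxx.
  by rewrite /in_square !latE /=; lia.
- case: j jr pd => [|j] jr; first by rewrite (flow_b0 F) // ltxx.
  by rewrite /in_square !latE /=; lia.
have E : mu m (sq i j) dNW = mu m (sq i.+1 j.+1) dW.
  rewrite -(mu_sym mT); congr (mu m _ _).
  by apply: lattice_eqP; rewrite ?latE /=; lia.
have [ei|ni] := eqVneq i r.
  by move: pd; rewrite E ei (flow_c_right F) // ltxx.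
have [ej|nj] := eqVneq j r.
  by move: pd; rewrite E ej (flow_c_top F) // ltxx.
by rewrite /in_square !latE /=; lia.
Qed.

Lemma outward_leaves P d n : outward d -> in_square r P -> 0 < mu m P d ->
  ~~ in_square r (P + dv d) ->
  ~~ in_square r (P + dv d *+ n.+1) && ray r d (P + dv d *+ n.+1).
Proof.
have F := tame_square mT; move=> od iP pd.
have [i [j [EP ir jr]]] : exists i j, [/\ P = sq i j, (i <= r)%N & (j <= r)%N].
  exists (absz P.1), (absz P.2); move: iP; rewrite /in_square => iP.
  by split; [apply: lattice_eqP => /=|..]; lia.
move: pd; rewrite EP {iP EP}; case: d od => // _ pd.
- by rewrite /in_square /ray !latE /=; lia.
- case: i ir pd => [|i] ir pd; last by rewrite /in_square /ray !latE /=; lia.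
  case: j jr pd => [|j] jr pd; last by move: pd; rewrite (flow_c0 F) // ltxx.
  by rewrite /in_square /ray !latE /=; lia.
- by rewrite /in_square /ray !latE /=; lia.
Qed.

End SquareSteps.

(** The left side is the share of one tree vertex, with edge set [D] and parent direction [p], in
    [pairing]. Keeping inward edges to children and outward edges to parents lets every tree edge
    but the root edge be counted at both ends with opposite signs, or at neither. *)
Lemma slack_identity (R : realType) (D : pred dir) p (w : dir -> R) :
  shape D -> D p ->
  w dV - w dNV = w dU - w dNU -> w dW - w dNW = w dU - w dNU ->
  (D dNU)%:R * w dNV + (D dNV)%:R * w dNW + (D dNW)%:R * w dNU
    - (w dU - w dNU) * ((D dU)%:R - (D dNU)%:R) =
  w (slack D p) + \sum_(d <- inwards) (D d && (d != p))%:R * w d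
    - \sum_(d <- outwards) (D d && (d == p))%:R * w d.
Proof.
move=> sD Dp E1 E2; rewrite !big_cons !big_nil /slack.
case: sD => [] [a Da]; move: Dp; rewrite !Da /=;
  by case: a Da => _; case: p => //= _; lra.
Qed.

Lemma natr_count (R : pzSemiRingType) (I : Type) (a : pred I) s :
  (count a s)%:R = \sum_(x <- s) (a x)%:R :> R.
Proof.
by elim: s => [|x s IHs]; rewrite ?big_nil // big_cons -IHs /= natrD.
Qed.

Section TreeSum.
Variables (R : realType) (r : nat) (X : choiceType) (T : lattice_tree X).
Variables (m m' : density R).
Hypotheses (mT : tame r m) (mT' : tame r m').
Hypothesis m'E : forall P d,
  mu m' P d = (count (fun x => dirs T x d) (fib T P))%:R.

Notation vx := (vx T).
Notation pos := (pos T).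
Notation dirs := (dirs T).
Notation nb := (nb T).
Notation fib := (fib T).

Lemma dirs_mu x d : vx x -> dirs x d -> 0 < mu m' (pos x) d.
Proof.
move=> vxx dx; rewrite m'E ltr0n -has_count; apply/hasP; exists x => //.
by rewrite mem_fib vxx eqxx.
Qed.

Lemma dirs_ray x e : vx x -> ~~ inside r (pos x) -> outward e ->
  ray r e (pos x) -> dirs x =1 [pred d | d \in [:: e; opp e]].
Proof.
move=> vxx nx oe re; apply: shape_straight => [|d dx]; first exact: dirs_shape.
have [f [of_ rf df]] := tame_outside mT' nx (dirs_mu vxx dx).
by rewrite (ray_inj oe of_ re rf).
Qed.

(** Outside the triangle a point lies on at most one exit ray, and every tree vertex over it is
    straight along that ray. *)
Lemma dirs_outside x y d : vx x -> vx y -> pos x = pos y ->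
  ~~ inside r (pos x) -> dirs x d = dirs y d.
Proof.
move=> vxx vy E nx.
have H z : vx z -> pos z = pos x ->
    exists e, [/\ outward e, ray r e (pos x) & dirs z =1 [pred d | d \in [:: e; opp e]]].
  move=> vz Ez; have [a za] : exists a, dirs z a.
    by case: (dirs_shape vz) => [] [a Da]; exists a; rewrite Da /= !inE eqxx.
  have := dirs_mu vz za; rewrite Ez => /(tame_outside mT' nx) [e [oe re _]].
  by exists e; split=> //; apply: dirs_ray; rewrite ?Ez.
have [e [oe re De]] := H x vxx erefl; have [f [of_ rf Df]] := H y vy (esym E).
by rewrite De Df (ray_inj oe of_ re rf).
Qed.

Definition square_vertices : seq X := [seq x | P <- squares r, x <- fib P].

Lemma mem_square_vertices x :
  (x \in square_vertices) = vx x && in_square r (pos x).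
Proof.
apply/allpairsPdep/idP => [[P [y []]]|/andP [vxx sx]].
  by rewrite mem_squares mem_fib => sP /andP [vy /eqP E] ->; rewrite vy E.
by exists (pos x), x; rewrite mem_squares mem_fib vxx eqxx.
Qed.

Lemma square_vertices_uniq : uniq square_vertices.
Proof.
apply: allpairs_uniq_dep => [|P _|]; [exact: squares_uniq|exact: fib_uniq|].
move=> [P x] [Q y] /allpairsPdep [P1 [x1 [_ H1 [E1 E1']]]].
move=> /allpairsPdep [Q1 [y1 [_ H2 [E2 E2']]]] /= E.
subst; move: H1 H2; rewrite !mem_fib => /andP [_ /eqP <-] /andP [_ /eqP <-].
by [].
Qed.

Lemma sum_square_vertices (f : X -> R) :
  \sum_(i < r.+1) \sum_(j < r.+1) \sum_(x <- fib (sq i j)) f x =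
  \sum_(x <- square_vertices) f x.
Proof.
rewrite /square_vertices big_allpairs_dep big_allpairs_dep.
rewrite -[iota 0 _]/(index_iota 0 r.+1) big_mkord; apply: eq_bigr => i _.
by rewrite big_mkord.
Qed.

Variables (x0 : X) (d0 : dir).
Hypotheses (vx0 : vx x0) (dx0 : dirs x0 d0).
Hypotheses (sx0 : in_square r (pos x0)) (od0 : outward d0).

Notation par := (par d0 vx0).

(** Otherwise the parent edge starts an exit ray, along which the tree is straight. The successive
    parents then move outward forever, although their words get shorter and the root lies in the
    square. *)
Lemma par_outward_square x : vx x -> x != x0 -> in_square r (pos x) ->
  outward (par x) -> in_square r (pos (nb x (par x))).
Proof.
move=> vxx nx sx opar; apply: contraT => npar.
have dpar := par_dirs vx0 dx0 vxx.
rewrite nb_pos // in npar.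
have Q n := outward_leaves mT' n opar sx (dirs_mu vxx dpar) npar.
(* [y] is an ancestor of [x] reached after [k] steps along the ray; the induction is on the length
   of its word. *)
suff H n y k : (size (word vx0 y) < n)%N -> vx y -> y != x0 -> par y = par x ->
    pos y = pos x + dv (par x) *+ k -> False.
  by exfalso; apply: (H _ x 0%N (leqnn _)) => //; rewrite mulr0n addr0.
elim: n y k => // n IHn y k sn vy ny Ey Py.
have dy := par_dirs vx0 dx0 vy.
have [n1 n2] : par (nb y (par y)) != opp (par y) /\
    (size (word vx0 (nb y (par y))) < size (word vx0 y))%N.
  apply: par_parent => //; rewrite Ey; apply: contraTneq opar => ->.
  by rewrite outward_opp od0.
have vz := nb_vx vy dy; have pz := nb_pos vy dy.
have Pz : pos (nb y (par y)) = pos x + dv (par x) *+ k.+1.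
  by rewrite pz Py Ey mulrSr addrA.
have /andP [sz rz] := Q k; rewrite -Pz in sz rz.
apply: (IHn (nb y (par y)) k.+1) => //.
- exact: leq_trans n2 sn.
- by apply: contraNneq sz => ->.
have := par_dirs vx0 dx0 vz; rewrite (dirs_ray vz (ray_outside rz) opar rz).
by rewrite /= !inE -Ey => /orP [/eqP //|/eqP E]; move: n1; rewrite E eqxx.
Qed.

Definition child_edges := [seq p <- [seq (x, d) | x <- square_vertices, d <- inwards]
  | dirs p.1 p.2 && (p.2 != par p.1)].
Definition parent_edges := [seq p <- [seq (x, d) | x <- square_vertices, d <- outwards]
  | dirs p.1 p.2 && (p.2 == par p.1)].

Lemma mem_pairs (I J : eqType) (s : seq I) (t : seq J) x d :
  ((x, d) \in [seq (x, d) | x <- s, d <- t]) = (x \in s) && (d \in t).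
Proof.
apply/allpairsP/andP => [[[y e] /= [ys et [-> ->]]]|[xs dt]]; first by [].
by exists (x, d).
Qed.

Lemma mem_child_edges x d : ((x, d) \in child_edges) =
  (dirs x d && (d != par x)) && ((vx x && in_square r (pos x)) && ~~ outward d).
Proof. by rewrite mem_filter mem_pairs mem_square_vertices mem_inwards. Qed.

Lemma mem_parent_edges x d : ((x, d) \in parent_edges) =
  (dirs x d && (d == par x)) && ((vx x && in_square r (pos x)) && outward d).
Proof. by rewrite mem_filter mem_pairs mem_square_vertices mem_outwards. Qed.

Lemma pairs_uniq (t : seq dir) : uniq t ->
  uniq [seq (x, d) | x <- square_vertices, d <- t].
Proof.
move=> ut; apply: allpairs_uniq => //; first exact: square_vertices_uniq.
by move=> [x d] [y e] _ _ /= [-> ->].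
Qed.

(** Reversing an inward edge to a child gives an outward edge to a parent. Only [(x0, d0)] is not
    obtained: the two ends of the root edge are parents of each other, so neither end sees it as an
    edge to a child. *)
Lemma parent_child_edges : perm_eq parent_edges
  ((x0, d0) :: [seq (nb p.1 p.2, opp p.2) | p <- child_edges]).
Proof.
apply: uniq_perm.
- by apply: filter_uniq; apply: pairs_uniq.
- rewrite /= map_inj_in_uniq; last first.
    move=> [x d] [y e]; rewrite !mem_child_edges.
    move=> /andP [/andP [dx _] /andP [/andP [vxx _] _]].
    move=> /andP [/andP [dy _] /andP [/andP [vy _] _]] /= [E Ed].
    move: (can_inj oppK Ed) => {}Ed; rewrite -Ed in dy E *.
    by rewrite -(nbK vxx dx) E nbK.
  rewrite filter_uniq ?pairs_uniq // andbT; apply/mapP => -[[x d]].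
  rewrite mem_child_edges => /andP [/andP [dx nd] /andP [/andP [vxx _] _]] /= [E _].
  by have [_] := par_child vxx dx nd; rewrite -E eqxx.
move=> [x d]; rewrite mem_parent_edges inE.
have [[-> ->]|nxd] := eqVneq (x, d) (x0, d0).
  by rewrite par_root dx0 eqxx vx0 sx0 od0.
apply/idP/mapP => [|[[y e]]].
  move=> /andP [/andP [dx /eqP Ed] /andP [/andP [vxx sx] od]].
  have nx : x != x0 by apply: contraNneq nxd => E; rewrite E Ed E par_root.
  exists (nb x d, opp d); last by rewrite /= nbK // oppK.
  rewrite mem_child_edges outward_opp od nb_opp // nb_vx //=.
  rewrite Ed par_outward_square -?Ed // !andbT Ed.
  have [n1 _] : par (nb x (par x)) != opp (par x) /\
      (size (word vx0 (nb x (par x))) < size (word vx0 x))%N.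
    by apply: par_parent => //; rewrite -Ed; apply: contraTneq od => ->; rewrite outward_opp od0.
  by rewrite eq_sym.
rewrite mem_child_edges => /andP [/andP [dy ne] /andP [/andP [vy sy] oe]] /= [-> ->].
have [-> _] := par_child vy dy ne.
rewrite nb_opp // eqxx nb_vx // outward_opp oe nb_pos //.
by rewrite (inward_square mT' oe sy (dirs_mu vy dy)).
Qed.

Lemma sum_pairs (t : seq dir) (a : X -> dir -> bool) (f : X -> dir -> R) :
  \sum_(x <- square_vertices) \sum_(d <- t) (a x d)%:R * f x d =
  \sum_(p <- [seq p <- [seq (x, d) | x <- square_vertices, d <- t] | a p.1 p.2])
     f p.1 p.2.
Proof.
rewrite big_filter [RHS]big_mkcond big_allpairs_dep /=.
by apply: eq_bigr => x _; apply: eq_bigr => d _; rewrite mulr_natl mulrb.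
Qed.

(** Each density of [m'] in [pairing] counts tree vertices, so [slack_identity] applies vertex by
    vertex. By [parent_child_edges] all edge terms cancel except that of the root edge. *)
Lemma Sigma_tree : Sigma r m' m =
  \sum_(x <- square_vertices) mu m (pos x) (slack (dirs x) (par x))
  - mu m (pos x0) d0.
Proof.
rewrite (Sigma_pairing mT mT').
pose term x := mu m (pos x) (slack (dirs x) (par x))
  + \sum_(d <- inwards) (dirs x d && (d != par x))%:R * mu m (pos x) d
  - \sum_(d <- outwards) (dirs x d && (d == par x))%:R * mu m (pos x) d.
transitivity (\sum_(x <- square_vertices) term x).
  rewrite -sum_square_vertices; apply: eq_bigr => i _; apply: eq_bigr => j _.
  rewrite /pairing !m'E !natr_count !mulr_suml -sumrB mulr_sumr.
  rewrite -!big_split -sumrB; apply: eq_big_seq => x /=.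
  rewrite mem_fib => /andP [vxx /eqP Ex].
  rewrite /term Ex -slack_identity //; [exact: dirs_shape|exact: par_dirs| |].
    exact: (mu_turnV mT).
  exact: (mu_turnW mT).
rewrite /term sumrB big_split /= -addrA; congr (_ + _).
rewrite (sum_pairs _ (fun x d => dirs x d && (d != par x)) (fun x d => mu m (pos x) d)).
rewrite (sum_pairs _ (fun x d => dirs x d && (d == par x)) (fun x d => mu m (pos x) d)).
rewrite (perm_big _ parent_child_edges) big_cons big_map /= opprD addrCA.
rewrite -[RHS]addr0; congr (_ + _); apply/eqP; rewrite subr_eq0; apply/eqP.
apply: eq_big_seq => -[x d]; rewrite mem_child_edges /=.
move=> /andP [/andP [dx _] /andP [/andP [vxx _] _]].
by rewrite nb_pos // (mu_sym mT).
Qed.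

End TreeSum.

(** * Parallel walks and the number of slacks *)

Lemma sum_inv s : \sum_(d <- inv s) dv d = - \sum_(d <- s) dv d.
Proof.
rewrite /inv big_rev big_map -sumrN.
by apply: eq_bigr => d _; rewrite dv_opp.
Qed.

Lemma sum_power s n : \sum_(d <- power s n) dv d = (\sum_(d <- s) dv d) *+ n.
Proof.
elim: n => [|n IHn]; first by rewrite big_nil mulr0n.
by rewrite /power /= big_cat IHn mulrS.
Qed.

Lemma size_power s n : size (power s n) = (n * size s)%N.
Proof. by elim: n => [//|n IHn]; rewrite /power /= size_cat IHn mulSn. Qed.

(* Otherwise [x0 |-> x1] would extend to a translation of the tree along the
   word from [x0] to [x1], which moves no point of the plane, so some fiber
   would be infinite. *)
Lemma tree_mismatch (X : choiceType) (T : lattice_tree X) x0 x1 :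
  vx T x0 -> vx T x1 -> x1 != x0 -> pos T x1 = pos T x0 ->
  exists s d, [/\ reduced s, valid (dirs T) (nb T) x0 s,
    valid (dirs T) (nb T) x1 s &
    dirs T (walk (nb T) x0 s) d != dirs T (walk (nb T) x1 s) d].
Proof.
move=> vx0 vx1 n10 p10; apply: contrapT => H.
have same s : reduced s -> valid (dirs T) (nb T) x0 s ->
    valid (dirs T) (nb T) x1 s.
  elim/last_ind: s => [//|s d IHs] rs.
  have [rs1 _] := reduced_rcons rs.
  rewrite -cats1 !valid_cat /= !andbT => /andP [v0 d0]; rewrite IHs //=.
  apply: contraPT H => nd; apply; exists s, d; split=> //; first exact: IHs.
  by rewrite d0 (negbTE nd).
have [ws [v0 rws w1]] := connected_words vx0 vx1.
have ws0 : ws != [::] by apply: contraNneq n10 => E; rewrite -w1 E.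
have [g [c [Ews c0 cc]]] := cyclic_reduction rws ws0.
move: (v0); rewrite Ews !valid_cat => /and3P [vg vc vg'].
set y := walk (nb T) x0 g in vc vg' *.
have vy : vx T y by exact: walk_vx.
have vyc : vx T (walk (nb T) y c) by exact: walk_vx.
have Ex1 : x1 = walk (nb T) (walk (nb T) y c) (inv g) by rewrite -w1 Ews !walk_cat.
(* The word from [x0] to [x1] is [g c g^-1], so walking [g] from [x1] undoes its last part. *)
have Eg : walk (nb T) x1 g = walk (nb T) y c.
  by have [_] := valid_inv vyc vg'; rewrite invK -Ex1.
have rgc : reduced (g ++ c) by move: rws; rewrite Ews catA => /reduced_catl.
(* By [same], validity of [g c^n] at [x0] gives validity at [x1], that is, of [c^n] after [y]
   followed by [c]; hence [c^(n+1)] is valid at [y]. *)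
have vpow n : valid (dirs T) (nb T) y (power c n).
  suff : valid (dirs T) (nb T) x0 (g ++ power c n) by rewrite valid_cat => /andP [].
  elim: n => [|n IHn]; first by rewrite cats0.
  have := same _ (reduced_power n c0 rgc cc) IHn.
  by rewrite /power /= !valid_cat Eg => /andP [_ v]; rewrite vg vc.
have rpow n : reduced (power c n).
  exact: reduced_catr (reduced_power n c0 rgc cc).
have sumc : \sum_(d <- c) dv d = 0.
  move: p10; rewrite -w1 walk_pos // Ews !big_cat /= sum_inv.
  by rewrite addrCA subrr addr0 -[RHS]addr0 => /addrI.
pose z n := walk (nb T) y (power c n).
have z_inj : injective z.
  move=> i j /(walk_inj vy (vpow i) (vpow j) (rpow i) (rpow j)).
  move/(congr1 size); rewrite !size_power => /eqP.
  by rewrite eqn_pmul2r; [move/eqP | case: (c) c0].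
(* The vertices [z n] are distinct and, since the steps of [c] add up to 0, all lie over [pos T y]:
   one too many for the fiber. *)
have := @uniq_leq_size _ [seq z n | n <- iota 0 (size (fib T (pos T y))).+1]
  (fib T (pos T y)).
rewrite map_inj_uniq // iota_uniq size_map size_iota ltnn => F; apply: notF.
apply: F => // _ /mapP [n _ ->]; rewrite mem_fib walk_vx //=.
by rewrite walk_pos // sum_power sumc mul0rn addr0.
Qed.

Section TreeCount.
Variables (R : realType) (r : nat) (X : choiceType) (T : lattice_tree X).
Variables (m m' : density R).
Hypotheses (mT : tame r m) (mT' : tame r m').
Hypothesis m'E : forall P d,
  mu m' P d = (count (fun x => dirs T x d) (fib T P))%:R.

Notation vx := (vx T).
Notation pos := (pos T).
Notation dirs := (dirs T).
Notation nb := (nb T).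
Notation fib := (fib T).
Notation valid := (valid dirs nb).
Notation walk := (walk nb).
Notation square_vertices := (square_vertices r T).

Section Rooted.
Variables (x0 : X) (d0 : dir).
Hypotheses (vx0 : vx x0) (dx0 : dirs x0 d0).
Hypotheses (sx0 : in_square r (pos x0)) (od0 : outward d0).

Notation par := (par d0 vx0).

(** The number of these pairs is the sum of the slacks of [m'], because each density of [m'] counts
    tree vertices. *)
Definition slack_pairs : seq (X * X) :=
  [seq (x, y) | x <- square_vertices,
     y <- [seq y <- fib (pos x) | dirs y (slack (dirs x) (par x))]].

Lemma slack_pair y : vx y -> y != x0 -> pos y = pos x0 -> dirs y d0 ->
  exists s, [/\ reduced s, valid x0 s, valid y s
    & (walk x0 s, walk y s) \in slack_pairs].
Proof.
move=> vy ny py dy; have [s [d [rs v0 v1 nd]]] := tree_mismatch vx0 vy ny py.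
exists s; split=> //.
have V0 := walk_vx vx0 v0; have V1 := walk_vx vy v1.
have E : pos (walk x0 s) = pos (walk y s) by rewrite !walk_pos // py.
(* Over a point outside the triangle all vertices have the same directions, so the mismatch occurs
   inside. *)
have sq0 : in_square r (pos (walk x0 s)).
  apply: contraNT nd => ns; apply/eqP.
  by apply: (dirs_outside mT' m'E) => //; apply: contra ns; exact: inside_square.
apply/allpairsPdep; exists (walk x0 s), (walk y s); split=> //.
  by rewrite mem_square_vertices V0.
rewrite mem_filter mem_fib V1 E eqxx !andbT.
have Vp := par_dirs vx0 dx0 V0.
(* The parent direction reverses the last step, which both walks have made; for the empty walk it is
   [d0], present at [y] by assumption. *)
suff Wp : dirs (walk y s) (par (walk x0 s)).
  exact: (slack_shape (dirs_shape V0) (dirs_shape V1) Vp Wp nd).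
rewrite /par word_walk //; case/lastP: s {nd V0 V1 E sq0 Vp} rs v0 v1 => [|s e] rs v0.
  by rewrite /= oppK.
rewrite last_rcons -!cats1 valid_cat walk_cat /= andbT => /andP [vs ds].
by rewrite nb_opp // walk_vx.
Qed.

(** The pair attached to [y] determines [y]: its first entry determines the reduced word from [x0],
    and following this word backwards from the second entry leads to [y]. The extra 1 accounts for
    [x0] itself. *)
Lemma count_slack_pairs :
  (count (fun y => dirs y d0) (fib (pos x0)) <= (size slack_pairs).+1)%N.
Proof.
pose F := [seq y <- fib (pos x0) | dirs y d0].
have uF : uniq F by rewrite filter_uniq // fib_uniq.
have xF : x0 \in F by rewrite mem_filter dx0 mem_fib vx0 eqxx.
rewrite -size_filter -/F -(prednK (n := size F)); last by case: (F) xF.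
rewrite ltnS -(size_rem xF).
have /choice [f Hf] : forall y, exists s, y \in rem x0 F ->
    [/\ reduced s, valid x0 s, valid y s & (walk x0 s, walk y s) \in slack_pairs].
  move=> y; have [yF|//] := boolP (y \in rem x0 F); last by exists [::].
  move: yF; rewrite mem_rem_uniq // !inE mem_filter mem_fib.
  move=> /andP [ny /and3P [dy vy /eqP Ey]].
  by have [s Hs] := slack_pair vy ny Ey dy; exists s.
have vrem y : y \in rem x0 F -> vx y.
  by move/mem_rem; rewrite mem_filter mem_fib => /and3P [].
rewrite -(size_map (fun y => (walk x0 (f y), walk y (f y)))).
apply: uniq_leq_size; last by move=> _ /mapP [y /Hf [_ _ _ ?] ->].
rewrite map_inj_in_uniq ?rem_uniq // => y z yF zF [E1 E2].
have [ry v0y vy _] := Hf y yF; have [rz v0z vz _] := Hf z zF.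
have Ef := walk_inj vx0 v0y v0z ry rz E1.
rewrite -Ef in vz E2; have [_ <-] := valid_inv (vrem _ yF) vy.
by rewrite E2; have [_ ->] := valid_inv (vrem _ zF) vz.
Qed.

Lemma sum_slack : mu m' (pos x0) d0 - 1 <=
  \sum_(x <- square_vertices) mu m' (pos x) (slack (dirs x) (par x)).
Proof.
under eq_bigr do rewrite m'E -size_filter.
rewrite -natr_sum m'E lerBlDr natr1 ler_nat.
apply: leq_trans count_slack_pairs _; rewrite ltnS size_allpairs_dep.
by rewrite sumnE big_map.
Qed.

Lemma Sigma_lower rho : 0 <= rho ->
  (forall P d, rho * mu m' P d <= mu m P d) ->
  mu m (pos x0) d0 = rho * mu m' (pos x0) d0 -> - rho <= Sigma r m' m.
Proof.
move=> rho0 le E; rewrite (Sigma_tree mT mT' m'E vx0 dx0 sx0 od0) E.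
apply: (@le_trans _ _ (rho * (mu m' (pos x0) d0 - 1) - rho * mu m' (pos x0) d0)).
  by rewrite mulrBr mulr1 addrAC subrr add0r.
rewrite lerD2r; apply: le_trans (ler_wpM2l rho0 sum_slack) _.
by rewrite mulr_sumr; apply: ler_sum => x _.
Qed.

End Rooted.

Lemma seq_argmin (I : eqType) (f : I -> R) (s : seq I) : s != [::] ->
  exists2 x, x \in s & forall y, y \in s -> f x <= f y.
Proof.
elim: s => // x [|z s] IHs _.
  by exists x; rewrite ?inE // => y; rewrite inE => /eqP ->.
have [//|y ys miny] := IHs; have [xy|yx] := leP (f x) (f y).
  exists x; rewrite ?inE ?eqxx // => t; rewrite inE => /orP [/eqP -> //|ts].
  exact: le_trans xy (miny t ts).
exists y; first by rewrite inE ys orbT.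
by move=> t; rewrite inE => /orP [/eqP ->|/miny //]; exact: ltW.
Qed.

(** An inward edge of the square is an outward edge from its other end, and densities on an exit ray
    equal those where the ray leaves the triangle. *)
Lemma le_everywhere rho : 0 <= rho ->
  (forall P d, in_square r P -> outward d -> rho * mu m' P d <= mu m P d) ->
  forall P d, rho * mu m' P d <= mu m P d.
Proof.
move=> rho0 H.
have H1 P d : in_square r P -> rho * mu m' P d <= mu m P d.
  move=> sP; have [od|od] := boolP (outward d); first exact: H.
  have := mu_ge0 mT' P d; rewrite le_eqVlt => /predU1P [<-|pd].
    by rewrite mulr0 (mu_ge0 mT).
  rewrite -(mu_sym mT') -(mu_sym mT); apply: H; rewrite ?outward_opp //.
  exact: (inward_square mT').
move=> P d; have [iP|nP] := boolP (inside r P); first by apply: H1; apply: inside_square.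
have := mu_ge0 mT' P d; rewrite le_eqVlt => /predU1P [<-|pd].
  by rewrite mulr0 (mu_ge0 mT).
have [e [oe re de]] := tame_outside mT' nP pd.
have E m1 : tame r m1 -> mu m1 P d = mu m1 P e.
  by move=> m1T; case: de => -> //; rewrite (mu_straight m1T).
have [Q [n [iQ hQ EP]]] := rayP oe re.
rewrite !E // EP (exit_ray mT' _ oe iQ hQ) (exit_ray mT _ oe iQ hQ).
by apply: H1; apply: inside_square.
Qed.

Lemma tree_le_of_Sigma p : (exists P d, inside r P /\ 0 < mu m' P d) ->
  Sigma r m' m = - p -> 0 < p -> forall P d, p * mu m' P d <= mu m P d.
Proof.
move=> [P0 [e0 [iP0 pe0]]] ES p0.
(* A finite list of edges carrying [m'], over which the ratio of the densities attains its minimum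
   [rho]; the minimizing edge becomes the root. *)
pose L := [seq q <- [seq (P, d) | P <- squares r, d <- outwards] | 0 < mu m' q.1 q.2].
have memL P d : ((P, d) \in L) = (0 < mu m' P d) && (in_square r P && outward d).
  by rewrite mem_filter mem_pairs mem_squares mem_outwards.
have L0 : L != [::].
  have [q qL] : exists q, q \in L.
    have [oe|ne] := boolP (outward e0).
      by exists (P0, e0); rewrite memL pe0 oe inside_square.
    exists (P0 + dv e0, opp e0); rewrite memL (mu_sym mT') pe0 outward_opp ne.
    by rewrite (inward_square mT') // inside_square.
  by apply: contraTneq qL => ->.
have [[P d] PdL minPd] := seq_argmin (fun q => mu m q.1 q.2 / mu m' q.1 q.2) L0.
move: PdL; rewrite memL => /and3P [pd sP od].
pose rho := mu m P d / mu m' P d.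
have rho0 : 0 <= rho by rewrite divr_ge0 ?(mu_ge0 mT) ?(mu_ge0 mT').
have le : forall Q e, rho * mu m' Q e <= mu m Q e.
  apply: le_everywhere => // Q e sQ oe.
  have := mu_ge0 mT' Q e; rewrite le_eqVlt => /predU1P [<-|qe].
    by rewrite mulr0 (mu_ge0 mT).
  by rewrite -ler_pdivlMr //; apply: (minPd (Q, e)); rewrite memL qe sQ oe.
have [x] : exists x, (x \in fib P) && dirs x d.
  move: pd; rewrite m'E ltr0n -has_count => /hasP [x xf dx].
  by exists x; rewrite xf.
rewrite mem_fib => /andP [/andP [vxx /eqP Ex] dx].
have : - rho <= Sigma r m' m.
  apply: (Sigma_lower vxx dx _ od rho0 le); rewrite Ex //.
  by rewrite /rho divfK // gt_eqF.
rewrite ES lerN2 => p_rho Q e; apply: le_trans (le Q e).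
by rewrite ler_wpM2r // (mu_ge0 mT').
Qed.

End TreeCount.

(** * From immersions to lattice trees *)

Lemma card_I_enum (U : pointedType) (A : set U) n : (A #= `I_n)%card ->
  exists f : nat -> U, [/\ forall i, (i < n)%N -> A (f i),
    forall i j, (i < n)%N -> (j < n)%N -> f i = f j -> i = j
    & forall y, A y -> exists2 i, (i < n)%N & f i = y].
Proof.
move=> /card_esym /card_set_bijP [f [fA fi fs]]; exists f; split.
- by move=> i ii; apply: fA.
- by move=> i j ii jj; apply: fi; rewrite inE.
- by move=> y /fs [i ii <-]; exists i.
Qed.

Lemma vorder_enum (R : realType) (e : rel (plane R)) x n : vorder e x n ->
  exists f : nat -> plane R, [/\ forall i, (i < n)%N -> e x (f i),
    forall i j, (i < n)%N -> (j < n)%N -> f i = f j -> i = j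
    & forall y, e x y -> exists2 i, (i < n)%N & f i = y].
Proof. by move=> /(@card_I_enum (R * R)%type [set y | e x y]%classic n). Qed.

Section Segments.
Variable R : realType.
Implicit Types x y a b : plane R.

Lemma plane_eqP x y : x.1 = y.1 -> x.2 = y.2 -> x = y.
Proof. by case: x y => [? ?] [? ?] /= -> ->. Qed.

Lemma segment_l x y : segment x y x.
Proof.
exists 0; first by rewrite /= in_itv /= lexx ler01.
by rewrite subr0 scale1r scale0r addr0.
Qed.

Lemma segmentC x y : segment x y = segment y x.
Proof.
rewrite predeqE => z; split=> -[t]; rewrite /= in_itv /= => /andP [t0 t1] <-;
  (exists (1 - t); first by rewrite /= in_itv /= subr_ge0 t1 lerBlDr lerDl);
  by rewrite subKr addrC.
Qed.

Lemma segment_r x y : segment x y y.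
Proof. by rewrite segmentC; exact: segment_l. Qed.

(** The parameters of [a] and [b] in [[0, 1]] differ by 1 in absolute value, so they are 0 and 1. *)
Lemma unit_segment_ends x y a b : eucl_dist x y = 1 -> eucl_dist a b = 1 ->
  segment x y a -> segment x y b -> (a = x /\ b = y) \/ (a = y /\ b = x).
Proof.
move=> xy ab [t]; rewrite /= in_itv /= => /andP [t0 t1] Ea.
move=> [s]; rewrite /= in_itv /= => /andP [s0 s1] Eb.
have Ea1 : a.1 = (1 - t) * x.1 + t * y.1 by rewrite -Ea.
have Ea2 : a.2 = (1 - t) * x.2 + t * y.2 by rewrite -Ea.
have Eb1 : b.1 = (1 - s) * x.1 + s * y.1 by rewrite -Eb.
have Eb2 : b.2 = (1 - s) * x.2 + s * y.2 by rewrite -Eb.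
have sq1 (u v : plane R) : eucl_dist u v = 1 -> (u.1 - v.1) ^+ 2 + (u.2 - v.2) ^+ 2 = 1.
  move=> uv; rewrite -[LHS]sqr_sqrtr ?addr_ge0 ?sqr_ge0 //.
  by rewrite -/(eucl_dist u v) uv expr1n.
have {}xy := sq1 _ _ xy; have {}ab := sq1 _ _ ab.
have ts : (t - s) ^+ 2 = 1.
  rewrite -[LHS]mulr1 -[in LHS]xy -[RHS]ab Ea1 Ea2 Eb1 Eb2; ring.
have : (t - s == 1) || (t - s == -1) by rewrite -eqf_sqr ts expr1n.
case/orP => /eqP E.
  have Et : t = 1 by lra.
  have Es : s = 0 by lra.
  by right; split; apply: plane_eqP; rewrite ?Ea1 ?Ea2 ?Eb1 ?Eb2 ?Et ?Es; lra.
have Et : t = 0 by lra.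
have Es : s = 1 by lra.
by left; split; apply: plane_eqP; rewrite ?Ea1 ?Ea2 ?Eb1 ?Eb2 ?Et ?Es; lra.
Qed.

End Segments.

(** * The star of a vertex under an immersion *)

Section Star.
Variables (R : realType) (T : tree R) (phi : plane R -> plane R).
Hypotheses (imm : immersion T phi) (onto : onto_small_edges T phi).
Implicit Types (x y z : plane R) (P Q : lattice).

Let e := adj T.

Definition lpos x : lattice := xget 0 [set P | phi x = pt R P]%classic.

Lemma adj_ends x y : e x y -> exists P d, phi x = pt R P /\ phi y = pt R (P + dv d).
Proof.
move=> exy; have eS : is_edge T (segment x y) by exists x, y.
have [P [Q [sPQ im]]] := onto eS.
have dxy : eucl_dist (phi x) (phi y) = 1.
  have [_ iso _ _] := imm.
  by rewrite (iso _ eS) ?(edge_length exy) //; [exact: segment_l|exact: segment_r].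
have sx : segment (pt R P) (pt R Q) (phi x) by rewrite -im; exists x => //; exact: segment_l.
have sy : segment (pt R P) (pt R Q) (phi y) by rewrite -im; exists y => //; exact: segment_r.
have /small_edgeP [d E] := sPQ.
case: (unit_segment_ends sPQ dxy sx sy) => [[-> ->]|[-> ->]].
  by exists P, d; rewrite E.
by exists Q, (opp d); rewrite E dvK.
Qed.

Lemma vertex_adj x : vertex T x -> exists y, e x y.
Proof.
by move=> vx; case: (vertex_order vx) => /vorder_enum [f [fA _ _]]; exists (f 0%N); apply: fA.
Qed.

Lemma lposP x : vertex T x -> phi x = pt R (lpos x).
Proof.
move=> /vertex_adj [y exy]; have [P [d [E _]]] := adj_ends exy.
by apply: (@xgetPex _ 0 [set P | phi x = pt R P]%classic); exists P.
Qed.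

Lemma adj_vertex_r x y : e x y -> vertex T y.
Proof. by rewrite /e adj_sym; exact: adj_vertex. Qed.

Lemma adj_dir x y : e x y -> exists d, lpos y = lpos x + dv d.
Proof.
move=> exy; have [P [d [Ex Ey]]] := adj_ends exy.
exists d; apply: (@pt_inj R).
rewrite -(lposP (adj_vertex_r exy)) Ey; congr pt; congr (_ + _).
by apply: (@pt_inj R); rewrite -Ex (lposP (adj_vertex exy)).
Qed.

Definition tdirs x (d : dir) : bool :=
  `[< exists y, e x y /\ lpos y = lpos x + dv d >].

Definition tnb x d : plane R := xget x [set y | e x y /\ lpos y = lpos x + dv d]%classic.

Lemma vorder2P x : vorder e x 2 -> exists a b,
  a <> b /\ forall y, e x y <-> y = a \/ y = b.
Proof.
move=> /vorder_enum [f [fA fi fs]].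
exists (f 0%N), (f 1%N); split; first by move=> /fi; move=> /(_ isT isT).
move=> y; split; last by case=> ->; apply: fA.
by move=> /fs [[|[|//]] _ <-]; [left|right].
Qed.

Lemma vorder3P x : vorder e x 3 -> exists a b c,
  uniq [:: a; b; c] /\ forall y, e x y <-> [\/ y = a, y = b | y = c].
Proof.
move=> /vorder_enum [f [fA fi fs]].
have neq i j : (i < 3)%N -> (j < 3)%N -> i != j -> f i != f j.
  by move=> i3 j3 ij; apply: contraNneq ij => /(fi _ _ i3 j3) ->.
exists (f 0%N), (f 1%N), (f 2); split.
  by rewrite /= !inE !negb_or !neq.
move=> y; split; last by case=> ->; apply: fA.
by move=> /fs [[|[|[|//]]] _ <-]; [apply: Or31|apply: Or32|apply: Or33].
Qed.

(** The barycenter conditions make the steps to the neighbors add up to 0: two such directions are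
    opposite, three are 120 degrees apart. In both cases they are distinct, so a direction
    determines the neighbor. *)
Lemma vertex_star x : vertex T x -> shape (tdirs x) /\
  forall y z, e x y -> e x z -> lpos y = lpos z -> y = z.
Proof.
move=> vx.
have tdirsP (d : dir) : reflect (exists y, e x y /\ lpos y = lpos x + dv d) (tdirs x d).
  exact: asboolP.
have phiE y d : e x y -> lpos y = lpos x + dv d -> phi y = pt R (lpos x) + pt R (dv d).
  by move=> exy E; rewrite (lposP (adj_vertex_r exy)) E ptD.
have [_ _ imm2 imm3] := imm.
case: (vertex_order vx) => ox.
  have [a [b [ab nbs]]] := vorder2P ox.
  have ea : e x a by apply/nbs; left.
  have eb : e x b by apply/nbs; right.
  have [da Ea] := adj_dir ea; have [db Eb] := adj_dir eb.
  have Edb : db = opp da.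
    apply: dv_inj; rewrite dv_opp; apply/eqP; rewrite -addr_eq0 addrC; apply/eqP.
    apply: (@pt_inj R); rewrite ptD.
    have := imm2 _ _ _ ox ab ea eb; rewrite (lposP vx) (phiE _ _ ea Ea) (phiE _ _ eb Eb).
    rewrite addrACA -mulr2n => /esym /(canRL (addKr _)); rewrite addNr => ->.
    by apply: (@addrI _ (pt R 0)); rewrite -ptD addr0 addr0.
  split.
    left; exists da => d; rewrite /= !inE -Edb; apply/tdirsP/orP.
      case=> y [/nbs [] ->]; rewrite ?Ea ?Eb => /addrI /dv_inj ->; [left|right];
        by rewrite eqxx.
    by case=> /eqP ->; [exists a|exists b].
  have nab : lpos a <> lpos b.
    by rewrite Ea Eb Edb => /addrI /dv_inj E; have := opp_neq da; rewrite -E eqxx.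
  by move=> y z /nbs [] -> /nbs [] -> // /esym.
have [a [b [c [uabc nbs]]]] := vorder3P ox.
have ea : e x a by apply/nbs; apply: Or31.
have eb : e x b by apply/nbs; apply: Or32.
have ec : e x c by apply/nbs; apply: Or33.
have [da Ea] := adj_dir ea; have [db Eb] := adj_dir eb; have [dc Ec] := adj_dir ec.
have sum0 : dv da + dv db + dv dc = 0.
  apply: (@pt_inj R); rewrite !ptD.
  have [] := imm3 _ _ _ _ ox uabc ea eb ec.
  rewrite (lposP vx) (phiE _ _ ea Ea) (phiE _ _ eb Eb) (phiE _ _ ec Ec) => E _.
  have gen (u1 u2 u3 u4 : plane R) : u1 + u2 + (u1 + u3) + (u1 + u4) = u1 *+ 3 + (u2 + u3 + u4).
    by rewrite (addrACA u1 u2) (addrACA (u1 + u1)) -mulr2n -mulrSr.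
  move: E; rewrite gen.
  move=> /esym /(canRL (addKr _)); rewrite addNr => ->.
  by apply: (@addrI _ (pt R 0)); rewrite -ptD addr0 addr0.
(* Names the neighbors in counterclockwise order starting from [a]; [b] and [c] may come in either
   order. *)
have star b' c' : e x b' -> e x c' -> lpos b' = lpos x + dv (rot2 da) ->
    lpos c' = lpos x + dv (rot2 (rot2 da)) ->
    (forall y, e x y -> [\/ y = a, y = b' | y = c']) ->
    shape (tdirs x) /\ forall y z, e x y -> e x z -> lpos y = lpos z -> y = z.
  move=> eb' ec' Eb' Ec' nbs'; split.
    right; exists da => d; rewrite /= !inE; apply/tdirsP/or3P.
      case=> y [/nbs' [] ->]; rewrite ?Ea ?Eb' ?Ec' => /addrI /dv_inj ->; rewrite eqxx;
        by [apply: Or31|apply: Or32|apply: Or33].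
    by case=> /eqP ->; [exists a|exists b'|exists c'].
  by move=> y z /nbs' [] -> /nbs' [] -> //; rewrite ?Ea ?Eb' ?Ec';
    move=> /addrI /dv_inj; case: (da).
have [[Edb Edc]|[Edc Edb]] : (db = rot2 da /\ dc = rot2 (rot2 da)) \/
    (dc = rot2 da /\ db = rot2 (rot2 da)).
- by move: sum0; case: (da); case: (db) => //; case: (dc) => //= _; by [left|right].
- by apply: (star b c) => //; [rewrite Eb Edb|rewrite Ec Edc|move=> y /nbs].
- apply: (star c b) => //; [by rewrite Ec Edc|by rewrite Eb Edb|].
  by move=> y /nbs []; [apply: Or31|apply: Or33|apply: Or32].
Qed.

End Star.

Lemma not_reducedP s : ~~ reduced s ->
  exists s1 d s2, s = s1 ++ d :: opp d :: s2.
Proof.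
elim: s => [//|d [//|f s] IHs]; rewrite /reduced /= negb_and negbK.
case/orP => [/eqP ->|H]; first by exists [::], d, s.
by have [s1 [g [s2 ->]]] := IHs H; exists (d :: s1), g, s2.
Qed.

Section TreeOfImmersion.
Variables (R : realType) (T : tree R) (phi : plane R -> plane R).
Hypotheses (imm : immersion T phi) (onto : onto_small_edges T phi).
Implicit Types (x y z : plane R) (P Q : lattice) (d : dir) (s : seq dir).

Notation e := (adj T).
Notation lpos := (lpos phi).
Notation tdirs := (tdirs T phi).
Notation tnb := (tnb T phi).
Notation valid := (valid tdirs tnb).
Notation walk := (walk tnb).

Lemma tnbP x d : tdirs x d -> e x (tnb x d) /\ lpos (tnb x d) = lpos x + dv d.
Proof. by move=> /asboolP H; apply: (xgetPex x H). Qed.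

Lemma tnb_eq x y d : e x y -> lpos y = lpos x + dv d -> tdirs x d /\ tnb x d = y.
Proof.
move=> exy Ey; have dx : tdirs x d by apply/asboolP; exists y.
split=> //; have [exz Ez] := tnbP dx.
have [_ inj] := vertex_star imm onto (adj_vertex exy).
by apply: inj => //; rewrite Ez Ey.
Qed.

Lemma tnb_vertex x d : tdirs x d -> vertex T (tnb x d).
Proof. by move=> /tnbP [exy _]; apply: adj_vertex_r exy. Qed.

Lemma tnbK x d : tdirs x d -> tdirs (tnb x d) (opp d) /\ tnb (tnb x d) (opp d) = x.
Proof.
move=> /tnbP [exy Ey]; apply: tnb_eq; first by rewrite adj_sym.
by rewrite Ey dvK.
Qed.

Lemma reduce_word x s : valid x s ->
  exists t, [/\ valid x t, reduced t & walk x t = walk x s].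
Proof.
have [n] := ubnP (size s); elim: n s => // n IHn s sn vs.
have [rs|/not_reducedP [s1 [d [s2 Es]]]] := boolP (reduced s); first by exists s.
move: vs; rewrite Es valid_cat /= => /and4P [v1 dx dy v2].
have [_ E] := tnbK dx; rewrite E in v2.
have [||t [vt rt Et]] := IHn (s1 ++ s2).
- by move: sn; rewrite Es !size_cat /=; lia.
- by rewrite valid_cat v1.
by exists t; split=> //; rewrite Et !walk_cat /= E.
Qed.

Lemma twalk_connected x y : vertex T x -> vertex T y ->
  exists s, [/\ valid x s, reduced s & walk x s = y].
Proof.
move=> vx vy; have [p xp <-] := tree_connected vx vy.
suff [s vs <-] : exists2 s, valid x s & walk x s = last x p by exact: reduce_word.
elim: p x xp {vx} => [|z p IHp] x /=; first by exists [::].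
move=> /andP [exz /IHp [s vs Es]].
have [d Ed] := adj_dir imm onto exz; have [dx Ez] := tnb_eq exz Ed.
by exists (d :: s); rewrite /= ?dx Ez.
Qed.

(** If the walk repeats no vertex before closing, it is a cycle of the tree; otherwise the part
    between two visits to a vertex is a shorter reduced closed walk. *)
Lemma twalk_acyclic x s : valid x s -> reduced s -> s != [::] -> walk x s <> x.
Proof.
have [n] := ubnP (size s); elim: n x s => // n IHn x s sn vs rs s0 closed.
pose f i := walk x (take i s).
have step i : (i < size s)%N -> tdirs (f i) (nth dV s i) /\
    f i.+1 = tnb (f i) (nth dV s i).
  move=> lis; rewrite /f (take_nth dV) // -cats1 walk_cat; split=> //.
  move: vs; rewrite -{1}(cat_take_drop i s) valid_cat (drop_nth dV) //=.
  by case/and3P.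
have adjf i : (i < size s)%N -> e (f i) (f i.+1).
  by move=> /step [di ->]; case: (tnbP di).
have posf i : (i < size s)%N -> lpos (f i.+1) = lpos (f i) + dv (nth dV s i).
  by move=> /step [di ->]; case: (tnbP di).
have f0 : f 0%N = x by rewrite /f take0.
have fn : f (size s) = x by rewrite /f take_size.
(* A closed walk of length 1 would have a zero displacement [dv d]; one of length 2 would go back
   along its edge, against [rs]. *)
have s2 : (2 < size s)%N.
  case: (s) s0 rs posf fn f0 => [//|d1 [|d2 [|//]]] _ rs posf fn f0.
    have := posf 0%N isT; rewrite fn f0 /= -[LHS]addr0 => /addrI /esym/eqP.
    by rewrite (negbTE (dv_neq0 _)).
  have := posf 1%N isT; rewrite fn posf // f0 /= -addrA -[LHS]addr0 => /addrI /esym.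
  move/eqP; rewrite addrC addr_eq0 -dv_opp => /eqP /dv_inj E.
  by move: rs; rewrite /reduced /= /noback E eqxx.
have [k Ek] : exists k, size s = k.+1 by exists (size s).-1; lia.
have cyc : cycle e (mkseq f (size s)).
  rewrite Ek /mkseq /= f0.
  have -> : rcons [seq f i | i <- iota 1 k] x = mkseq (f \o S) k.+1.
    by rewrite mkseqS /= -Ek fn; congr rcons; rewrite /mkseq (iotaDl 1 0) -map_comp.
  apply/(pathP x) => i; rewrite size_mkseq => ik; rewrite nth_mkseq //.
  case: i ik => [|i] ik /=; first by rewrite -f0; apply: adjf; rewrite Ek.
  by rewrite nth_mkseq //=; [apply: adjf; rewrite Ek|exact: ltnW].
have [uf|] := boolP (uniq (mkseq f (size s))).
  apply: (@tree_acyclic _ T (mkseq f (size s))); rewrite ?size_mkseq //.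
  exact/andP.
move=> /(uniqPn x) [i [j [ij]]]; rewrite size_mkseq => jn.
rewrite !nth_mkseq ?(ltn_trans ij) // => Eij.
have Es : s = take i s ++ take (j - i) (drop i s) ++ drop j s.
  have -> : drop j s = drop (j - i) (drop i s) by rewrite drop_drop subnK // ltnW.
  by rewrite !cat_take_drop.
have Ej : take j s = take i s ++ take (j - i) (drop i s).
  by rewrite -[j in LHS](subnKC (ltnW ij)) takeD.
have vij : valid (f i) (take (j - i) (drop i s)).
  by move: vs; rewrite {1}Es !valid_cat => /and3P [].
apply: (IHn (f i) (take (j - i) (drop i s))) => //.
- by rewrite size_take size_drop; case: ifP; lia.
- by move: rs; rewrite {1}Es => /reduced_catr /reduced_catl.
- rewrite -size_eq0 size_take size_drop -lt0n; case: ifP => _; rewrite subn_gt0 //.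
  exact: ltn_trans ij jn.
by rewrite -walk_cat -Ej -/(f j) Eij.
Qed.

Variable m : density R.
Hypothesis push : is_pushforward T phi m.

Lemma edge_image x y : e x y ->
  (phi @` segment x y = segment (phi x) (phi y))%classic.
Proof.
move=> exy; have eS : is_edge T (segment x y) by exists x, y.
have [P [Q [sPQ im]]] := onto eS; rewrite im.
have dxy : eucl_dist (phi x) (phi y) = 1.
  have [_ iso _ _] := imm.
  by rewrite (iso _ eS) ?(edge_length exy) //; [exact: segment_l|exact: segment_r].
have sx : segment (pt R P) (pt R Q) (phi x) by rewrite -im; exists x => //; exact: segment_l.
have sy : segment (pt R P) (pt R Q) (phi y) by rewrite -im; exists y => //; exact: segment_r.
by case: (unit_segment_ends sPQ dxy sx sy) => [[-> ->]|[-> ->]] //; rewrite segmentC.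
Qed.

Lemma small_dist P d : eucl_dist (pt R P) (pt R (P + dv d)) = 1.
Proof. by apply/small_edgeP; exists d. Qed.

(** The push-forward counts edges of the tree over a small edge; each such edge is replaced by its
    end over [P], from which the direction [d] recovers it. *)
Lemma vertices_over P d : exists L : seq (plane R),
  [/\ uniq L, mu m P d = (size L)%:R &
      forall x, x \in L <-> [/\ vertex T x, lpos x = P & tdirs x d]].
Proof.
have [n [/card_I_enum [f [fA fi fs]] mE]] := push (small_dist P d).
pose start (S : set (plane R)) x := exists y,
  [/\ e x y, lpos x = P, lpos y = P + dv d & S = segment x y].
have fP i : (i < n)%N -> exists x, start (f i) x.
  move=> /fA [[x [y [exy ->]]]]; rewrite edge_image // => Eim.
  have vx := adj_vertex exy; have vy := adj_vertex_r exy.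
  have dxy : eucl_dist (phi x) (phi y) = 1.
    have [d' E] := adj_dir imm onto exy.
    by rewrite (lposP imm onto vx) (lposP imm onto vy) E small_dist.
  have sx : segment (pt R P) (pt R (P + dv d)) (phi x) by rewrite -Eim; exact: segment_l.
  have sy : segment (pt R P) (pt R (P + dv d)) (phi y) by rewrite -Eim; exact: segment_r.
  have := unit_segment_ends (small_dist P d) dxy sx sy.
  rewrite (lposP imm onto vx) (lposP imm onto vy).
  case=> [[/pt_inj Ex /pt_inj Ey]|[/pt_inj Ex /pt_inj Ey]].
    by exists x, y.
  by exists y, x; split=> //; rewrite 1?adj_sym 1?segmentC.
pose g i := xget (0 : plane R) (start (f i)).
have gP i : (i < n)%N -> start (f i) (g i) by move=> /fP; exact: xgetPex.
exists (mkseq g n); split.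
- apply/(uniqP (0 : plane R)) => i j; rewrite !inE size_mkseq => ii jj.
  rewrite !nth_mkseq // => E; apply: fi => //.
  have [y [exy Ex Ey ->]] := gP i ii; have [z [exz _ Ez ->]] := gP j jj.
  rewrite E in exy Ex *; have [_ <-] := tnb_eq exz (etrans Ez (congr1 (+%R^~ _) (esym Ex))).
  by have [_ <-] := tnb_eq exy (etrans Ey (congr1 (+%R^~ _) (esym Ex))).
- by rewrite size_mkseq.
move=> x; split.
  move=> /mapP [i]; rewrite mem_iota => ii ->; have [y [exy Ex Ey _]] := gP i ii.
  split=> //; first exact: adj_vertex exy.
  by apply/asboolP; exists y; rewrite Ey Ex.
move=> [vx Ex dx]; have [exy Ey] := tnbP dx.
have [|i ii Ei] := fs (segment x (tnb x d)).
  split; first by exists x, (tnb x d).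
  rewrite edge_image // (lposP imm onto vx) (lposP imm onto (adj_vertex_r exy)).
  by rewrite Ey Ex.
apply/mapP; exists i; first by rewrite mem_iota.
have [z [egz Eg Ez]] := gP i ii; rewrite Ei => Eseg.
have sx : segment (g i) z x by rewrite -Eseg; exact: segment_l.
have sy : segment (g i) z (tnb x d) by rewrite -Eseg; exact: segment_r.
case: (unit_segment_ends (edge_length egz) (edge_length exy) sx sy) => [[-> //]|[Exz _]].
move: Ez; rewrite -Exz Ex -[LHS]addr0 => /addrI /esym/eqP.
by rewrite (negbTE (dv_neq0 _)).
Qed.

Definition all_dirs := [:: dV; dNU; dW; dNV; dU; dNW].
Lemma mem_all_dirs d : d \in all_dirs. Proof. by case: d. Qed.

Lemma tree_lattice_tree : exists LT : lattice_tree (plane R),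
  forall P d, mu m P d = (count (fun x => dirs LT x d) (fib LT P))%:R.
Proof.
have /choice [L HL] : forall Pd : lattice * dir, exists L : seq (plane R),
    [/\ uniq L, mu m Pd.1 Pd.2 = (size L)%:R &
      forall x, x \in L <-> [/\ vertex T x, lpos x = Pd.1 & tdirs x Pd.2]].
  by move=> [P d]; exact: vertices_over.
pose tvx x : bool := `[< vertex T x >].
(* Every vertex has a neighbor, hence an edge in one of the six directions, so these finite lists
   exhaust the fiber. *)
pose tfib P := undup (flatten [seq L (P, d) | d <- all_dirs]).
have mem_tfib P x : (x \in tfib P) = tvx x && (lpos x == P).
  rewrite mem_undup; apply/flatten_mapP/andP => [[d _]|[/asboolP vx /eqP Ex]].
    by have [_ _ ->] := HL (P, d) => -[vx Ex _]; split; [apply/asboolP|apply/eqP].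
  have [y exy] := vertex_adj vx; have [d Ed] := adj_dir imm onto exy.
  exists d; first exact: mem_all_dirs.
  by have [_ _ ->] := HL (P, d); split=> //; case: (tnb_eq exy Ed).
unshelve eexists (@LatticeTree _ tvx lpos tdirs tnb tfib _ _ _ _ _ _ _ _ mem_tfib).
- by move=> x d _ dx; apply/asboolP; exact: tnb_vertex.
- by move=> x d _ /tnbP [].
- by move=> x d _ /tnbK [].
- by move=> x d _ /tnbK [].
- by move=> x /asboolP vx; case: (vertex_star imm onto vx).
- by move=> x y /asboolP vx /asboolP vy; exact: twalk_connected.
- by move=> x s _; exact: twalk_acyclic.
- by move=> P; exact: undup_uniq.
move=> P d /=; have [uL -> memL] := HL (P, d); congr (_%:R).
rewrite -size_filter; apply/perm_size/uniq_perm => //.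
  by rewrite filter_uniq // undup_uniq.
move=> x; rewrite mem_filter mem_tfib; apply/idP/and3P => [/memL /= [vx -> dx]|].
  by rewrite dx eqxx; split=> //; apply/asboolP.
by case=> dx /asboolP vx /eqP Ex; apply/memL.
Qed.

End TreeOfImmersion.

(** * The theorem *)

(** If [A] is infinite, so is its image, and [fset_set] takes its default value on both sides. *)
Lemma card_fset_set_image (T U : choiceType) (f : T -> U) (A : set T) :
  injective f -> #|` fset_set (f @` A)%classic|%fset = #|` fset_set A|%fset.
Proof.
move=> inj; have [fA|nA] := pselect (finite_set A).
  by rewrite fset_set_image // card_imfset.
have nfA : ~ finite_set (f @` A)%classic.
  by rewrite (eq_finite_set (inj_card_eq (in2W inj))).
by rewrite /fset_set; case: pselect => // _; case: pselect.
Qed.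

(** * Sums and differences of measures, and integrality *)

Section Closure.
Variables (R : realType) (r : nat).
Hypothesis r1 : (1 <= r)%N.
Implicit Types (m n : density R) (P Q : lattice) (p : R).

Lemma mu_sub m n p P d : mu (m - p *: n) P d = mu m P d - p * mu n P d.
Proof. by []. Qed.

Lemma mu_add m n p P d : mu (m + p *: n) P d = mu m P d + p * mu n P d.
Proof. by []. Qed.

Lemma is_measure_sub m n p : is_measure m -> is_measure n ->
  (forall P d, p * mu n P d <= mu m P d) -> is_measure (m - p *: n).
Proof.
move=> [sm gm zm /mu_balanced bm] [sn gn zn /mu_balanced bn] le.
have E P Q : (m - p *: n) P Q = m P Q - p * n P Q by [].
split.
- by move=> P Q; rewrite !E sm sn.
- move=> P Q; rewrite E; have [/small_edgeP [d ->]|ne] := pselect (small_edge R P Q).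
    by rewrite subr_ge0; exact: le.
  by rewrite zm // zn // mulr0 subr0.
- by move=> P Q ne; rewrite E zm // zn // mulr0 subr0.
apply/mu_balanced => P; rewrite !mu_sub.
have [a1 a2] := bm P; have [b1 b2] := bn P.
have c1 := congr1 ( *%R p) b1; have c2 := congr1 ( *%R p) b2.
by split; lra.
Qed.

Lemma is_measure_add m n p : 0 <= p -> is_measure m -> is_measure n ->
  is_measure (m + p *: n).
Proof.
move=> p0 [sm gm zm /mu_balanced bm] [sn gn zn /mu_balanced bn].
have E P Q : (m + p *: n) P Q = m P Q + p * n P Q by [].
split.
- by move=> P Q; rewrite !E sm sn.
- by move=> P Q; rewrite E addr_ge0 // mulr_ge0.
- by move=> P Q ne; rewrite E zm // zn // mulr0 addr0.
apply/mu_balanced => P; rewrite !mu_add.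
have [a1 a2] := bm P; have [b1 b2] := bn P.
have c1 := congr1 ( *%R p) b1; have c2 := congr1 ( *%R p) b2.
by split; lra.
Qed.

Lemma measure_neq0 m : is_measure m -> m <> 0 -> exists P d, 0 < mu m P d.
Proof.
move=> [_ ge0 z _] m0; apply: contrapT => H; apply: m0.
apply/funext => P; apply/funext => Q; apply/eqP; rewrite eq_le ge0 andbT leNgt.
apply/negP => pos; have [/small_edgeP [d E]|ne] := pselect (small_edge R P Q).
  by apply: H; exists P, d; rewrite /mu -E.
by move: pos; rewrite z // ltxx.
Qed.

(* A measure without branch points is a sum of lines, and one end of each line
   is not an exit ray. *)
Lemma tame_branch m P d : tame r m -> 0 < mu m P d -> exists Q, branch_point m Q.
Proof.
move=> mT pd; apply: contrapT => nb.
have str Q e : mu m Q (opp e) = mu m Q e.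
  by apply: (mu_unbranched mT) => bQ; apply: nb; exists Q.
have [e [oe pe]] : exists e, outward e /\ 0 < mu m P e.
  have [od|od] := boolP (outward d); first by exists d.
  by exists (opp d); rewrite outward_opp od str.
have far k : 0 < mu m (P + dv (opp e) *+ k) (opp e).
  elim: k => [|k IHk]; first by rewrite addr0 str.
  by rewrite mulrSr addrA -(str _ (opp e)) (mu_sym mT).
pose k := (absz P.1 + absz P.2 + r + 1)%N.
have [|f [of_ rf]] := tame_outside mT _ (far k).
  by rewrite /inside ?latE /k; case: e oe {pe far} => //= _; lia.
move=> ef; have {ef} E : f = e by move: oe of_ ef; case: (e); case: (f) => //= _ _ [].
by move: rf; rewrite E /ray ?latE /k; case: e oe {pe far E} => //= _; lia.
Qed.

Lemma in_M_intro m : is_measure m ->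
  (forall P, branch_point m P -> inside r P) -> gated r m ->
  (m = 0 \/ exists P, branch_point m P) -> in_M r m.
Proof.
move=> mm bi g [m0|b]; split=> //; [by left|right; split=> // P /bi].
by move/(triangleP R P r1).
Qed.

(** The difference is bounded by [m], so it has no branch points or mass in new places. That it has
    a branch point when nonzero follows from [tame_branch]. *)
Lemma in_M_sub m n p : in_M r m -> in_M r n -> 0 <= p ->
  (forall P d, p * mu n P d <= mu m P d) -> in_M r (m - p *: n).
Proof.
move=> mM nM p0 le; have mT := in_M_tame r1 mM; have nT := in_M_tame r1 nM.
have mm := is_measure_sub (proj1 mM) (proj1 nM) le.
have le_m P d : mu (m - p *: n) P d <= mu m P d.
  by rewrite mu_sub lerBlDr lerDl mulr_ge0 // (mu_ge0 nT).
have bi P : branch_point (m - p *: n) P -> inside r P.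
  move=> /branch_pointP [d1 [d2 [d3 [ud p1 p2 p3]]]].
  by apply: (mu_branch mT ud); exact: lt_le_trans (le_m _ _).
have g : gated r (m - p *: n).
  move=> j jr; have [a1 b1 c1] := in_M_gates mM jr; have [a2 b2 c2] := in_M_gates nM jr.
  have E P Q : (m - p *: n) P Q = m P Q - p * n P Q by [].
  by rewrite !E a1 b1 c1 a2 b2 c2 mulr0 subr0.
apply: in_M_intro => //.
have [->|n0] := pselect (m - p *: n = 0); [by left|right].
have [P [d pd]] := measure_neq0 mm n0.
apply: (tame_branch (P := P) (d := d)) => //; split; last first.
  by move=> Q e nQ pe; apply: (tame_outside mT) => //; exact: lt_le_trans (le_m _ _).
have [sm gm _ /mu_balanced bm] := mm; have /gatedP G := g.
split.
- by move=> Q e; rewrite /mu dvK sm.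
- by move=> Q e; exact: gm.
- by move=> Q; case: (bm Q).
- by move=> Q; case: (bm Q).
- by move=> i ir; rewrite mu_sub (mu_gateA mT ir) (mu_gateA nT ir) mulr0 subr0.
- by move=> i ir; rewrite mu_sub (mu_gateB mT ir) (mu_gateB nT ir) mulr0 subr0.
- by move=> i ir; rewrite mu_sub (mu_gateC mT ir) (mu_gateC nT ir) mulr0 subr0.
- by move=> Q d1 d2 d3 ud p1 p2 p3; apply: bi; apply/branch_pointP; exists d1, d2, d3.
Qed.

(** Outside the triangle both measures live on the same disjoint exit rays, so the sum cannot branch
    there; a branch point of [n] remains one of the sum. *)
Lemma in_M_add m n p : in_M r m -> in_M r n -> n <> 0 -> 0 < p ->
  in_M r (m + p *: n).
Proof.
move=> mM nM n0 p0; have mT := in_M_tame r1 mM; have nT := in_M_tame r1 nM.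
apply: in_M_intro.
- by apply: is_measure_add; [exact: ltW|case: mM|case: nM].
- move=> P /branch_pointP [d1 [d2 [d3 [ud p1 p2 p3]]]]; apply: contraT => nP.
  have ray_dir d : 0 < mu (m + p *: n) P d ->
      exists e, [/\ outward e, ray r e P & d = e \/ d = opp e].
    move=> pd; have [pm|] := ltP 0 (mu m P d); first exact: (tame_outside mT).
    move=> m0; apply: (tame_outside nT) => //; rewrite lt_neqAle (mu_ge0 nT) andbT.
    by apply: contraTneq pd => E; rewrite mu_add -E mulr0 addr0 -leNgt.
  have [e1 [out1 r1' E1]] := ray_dir _ p1; have [e2 [out2 r2 E2]] := ray_dir _ p2.
  have [e3 [out3 r3 E3]] := ray_dir _ p3.
  rewrite -(ray_inj out1 out2 r1' r2) in E2; rewrite -(ray_inj out1 out3 r1' r3) in E3.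
  by move: ud; case: E1 => ->; case: E2 => ->; case: E3 => ->;
    rewrite /= !inE !eqxx ?orbT ?andbF.
- move=> j jr; have [a1 b1 c1] := in_M_gates mM jr; have [a2 b2 c2] := in_M_gates nM jr.
  have E P Q : (m + p *: n) P Q = m P Q + p * n P Q by [].
  by rewrite !E a1 b1 c1 a2 b2 c2 mulr0 addr0.
right; case: nM => _ [//|[[P /branch_pointP [d1 [d2 [d3 [ud p1 p2 p3]]]]] _ _]].
exists P; apply/branch_pointP; exists d1, d2, d3; rewrite !mu_add; split=> //;
  by rewrite ltr_wpDl ?(mu_ge0 mT) // mulr_gt0.
Qed.

Lemma Sigma_same_exit m n n' : same_exit r n n' -> Sigma r m n = Sigma r m n'.
Proof.
move=> H; rewrite /Sigma; have E (j : 'I_r.+1) := H j (ltn_ord j).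
congr (_ - _ * _).
  by apply: eq_bigr => i _; apply: eq_bigr => j _; have [-> -> ->] := E i.
by apply: eq_bigr => i _; have [-> _ _] := E i.
Qed.

Lemma alpha_int m j : integer_densities m -> alpha m j \is a Num.int.
Proof.
by move=> mi; rewrite alphaE; apply: mi; apply/small_edgeP; exists dW.
Qed.
Lemma beta_int m j : integer_densities m -> beta r m j \is a Num.int.
Proof.
by move=> mi; rewrite betaE; apply: mi; apply/small_edgeP; exists dU.
Qed.
Lemma gamma_int m j : integer_densities m -> gamma r m j \is a Num.int.
Proof.
by move=> mi; rewrite gammaE; apply: mi; apply/small_edgeP; exists dV.
Qed.

Lemma Sigma_int m n : integer_densities m -> integer_densities n ->
  Sigma r m n \is a Num.int.
Proof.
move=> mi ni; apply: rpredB.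
  apply: rpred_sum => i _; apply: rpred_sum => j _.
  by apply: rpredD; [apply: rpredD|]; apply: rpredM;
    rewrite ?alpha_int ?beta_int ?gamma_int.
by apply: rpredM; apply: rpred_sum => i _; apply: alpha_int.
Qed.

End Closure.

Theorem corollary4p3 (R : realType) (r : nat) (m m' : density R) (p : R) :
  (1 <= r)%N ->
  in_M r m -> in_M r m' ->
  rigid r m' -> extremal r m' -> tree_measure r m' ->
  Sigma r m' m = - p -> - p < 0 ->
  measure_le (p *: m') m /\
  (integer_densities m ->
     [/\ in_M r (m - p *: m'), integer_densities (m - p *: m')
       & coef r (m - p *: m') = coef r m]).
Proof.
move=> r1 mM mM' _ [_ m'0 _] [_ [T [phi [imm onto push]]]] ES; rewrite oppr_lt0 => p0.
have mT' := in_M_tame r1 mM'.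
have [LT m'E] := tree_lattice_tree imm onto push.
have m'pos : exists P d, inside r P /\ 0 < mu m' P d.
  case: mM' => _ [//|[[P /branch_pointP [d1 [d2 [d3 [ud p1 p2 p3]]]]] _ _]].
  by exists P, d1; split=> //; exact: (mu_branch mT' ud p1 p2 p3).
(* Proved for all measures with the exits of [m], since [p *: m'] is going to be subtracted from
   every element of [coef_set r m]. *)
have le n : in_M r n -> same_exit r n m -> forall P d, p * mu m' P d <= mu n P d.
  move=> nM nm; apply: (tree_le_of_Sigma (in_M_tame r1 nM) mT' m'E) => //.
  by rewrite (Sigma_same_exit m' nm).
have mm : same_exit r m m by [].
split; first by move=> P _ /small_edgeP [d ->]; exact: le.
move=> mi.
have mi' : integer_densities m'.
  by move=> P Q /push [k [_ ->]]; rewrite rpred_nat.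
(* [p] is minus [Sigma], an integer polynomial in the exit densities. *)
have pi : p \is a Num.int.
  by rewrite -[p]opprK -ES rpredN; exact: Sigma_int.
have sub_int n : integer_densities n -> integer_densities (n - p *: m').
  move=> ni P Q e; have -> : (n - p *: m') P Q = n P Q - p * m' P Q by [].
  by rewrite rpredB ?rpredM ?ni ?mi'.
have add_int n : integer_densities n -> integer_densities (n + p *: m').
  move=> ni P Q e; have -> : (n + p *: m') P Q = n P Q + p * m' P Q by [].
  by rewrite rpredD ?rpredM ?ni ?mi'.
split; [exact: (in_M_sub r1 mM mM' (ltW p0) (le m mM mm))|exact: sub_int|].
rewrite /coef.
(* Adding [p *: m'] gives preimages, and [le] keeps the differences positive. *)
have -> : coef_set r (m - p *: m') = ((fun n => n - p *: m') @` coef_set r m)%classic.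
  rewrite predeqE => n; split=> [[nM ni ne]|[k [kM ki ke] <-]].
    exists (n + p *: m'); last by rewrite addrK.
    split; [exact: in_M_add|exact: add_int|].
    move=> j /ne [a b c].
    split; rewrite /alpha /beta /gamma in a b c *.
    - have -> : (n + p *: m') (ptA j) (ptX j) = n (ptA j) (ptX j) + p * m' (ptA j) (ptX j) by [].
      by rewrite a; exact: subrK.
    - have -> : (n + p *: m') (ptB r j) (ptY r j) = n (ptB r j) (ptY r j) + p * m' (ptB r j) (ptY r j) by [].
      by rewrite b; exact: subrK.
    - have -> : (n + p *: m') (ptC r j) (ptZ r j) = n (ptC r j) (ptZ r j) + p * m' (ptC r j) (ptZ r j) by [].
      by rewrite c; exact: subrK.
  split; [exact: (in_M_sub r1 kM mM' (ltW p0) (le k kM ke))|exact: sub_int|].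
  move=> j /ke [a b c]; rewrite /alpha /beta /gamma in a b c *.
  by split; [congr (_ - _)|congr (_ - _)|congr (_ - _)].
by apply: card_fset_set_image => k l /addIr.
Qed.
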